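(* Let $\phi:\mathbb R^n\to\overline{\mathbb R}$ be a distance generating function that is Legendre and 1-coercive, and let $X=\operatorname{dom}\phi$. Let $f:X\to\overline{\mathbb R}$ be proper, lsc and convex with $\operatorname{dom} f\cap\operatorname{int}X\neq\emptyset$, and let $\tilde f:\mathbb R^n\to\overline{\mathbb R}$ be its canonical extension. Then the following are equivalent: (a) $f$ is B-smooth, i.e. $f$ is differentiable on $\operatorname{int}X$ and $\phi-f$ is convex on $\operatorname{int}X$. (b) $\operatorname{dom} f=X$ and $f(x)=\phi(x)-(h^* )(-x)$ for all $x\in\operatorname{int}X$, where $h:\mathbb R^n\to\overline{\mathbb R}$ is given by $h(\eta)=\sup_{\xi\in\mathbb R^n}\{\phi^*(\xi-\eta)-\tilde f^*(\xi)\}$. (c) $f$ satisfies the extended B-cocoercivity inequality: $f$ is differentiable on $\operatorname{int}X$ and $$f(\bar x)-f(x)-\langle \xi,\bar x-x\rangle\ \ge\ D_{\phi^*}\bigl(\nabla\phi(\bar x)-(\nabla f(\bar x)-\xi),\,\nabla\phi(\bar x)\bigr)\qquad\forall \bar x\in\operatorname{int}X,\ \forall (x,\xi)\in\operatorname{gph}\partial f.$$ (d) The Fenchel conjugate $\tilde f^*$ satisfies the anisotropic strong convexity inequality relative to $\phi^*$: $$\tilde f^*(\xi)\ \ge\ \tilde f^*(\bar\xi)+\phi^*\bigl(\xi-\bar\xi+\nabla\phi(\bar x)\bigr)-\phi^*(\nabla\phi(\bar x))\qquad\forall \xi,\bar\xi\in\mathbb R^n,\ \forall\bar x\in\partial\tilde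 f^*(\bar\xi)\cap\operatorname{int}X.$$ All these equivalent conditions imply: (e) $f$ is differentiable on $\operatorname{int}X$ and satisfies the B-cocoercivity inequality $$f(\bar x)-f(x)-\langle\nabla f(x),\bar x-x\rangle\ \ge\ D_{\phi^*}\bigl(\nabla\phi(\bar x)-(\nabla f(\bar x)-\nabla f(x)),\,\nabla\phi(\bar x)\bigr)\qquad\forall x,\bar x\in\operatorname{int}X.$$ A sufficient condition for the converse implication (that (e) implies (a)--(d)) is $\operatorname{dom}\partial f\subseteq\operatorname{int}X$ (equivalently, $\operatorname{dom}\partial f=\operatorname{dom}\nabla f=\operatorname{int}X$), as is the case when $X$ is open or when $f$ is essentially smooth.
   Context: $\overline{\mathbb R}=\mathbb R\cup\{\pm\infty\}$. For $S\subseteq\mathbb R^n$ and $f:S\to\overline{\mathbb R}$: $\operatorname{dom}f=\{x\in S: f(x)<\infty\}$; $f$ is proper if $f\not\equiv\infty$ and $f>-\infty$; lower semicontinuity (lsc) is relative to the subspace topology of $S$. A distance generating function (dgf) is a proper, lsc, convex function $\phi:\mathbb R^n\to\overline{\mathbb R}$ that is differentiable on $\operatorname{int}\operatorname{dom}\phi\neq\emptyset$. It is Legendre if it is essentially smooth (differentiable on $\operatorname{int}\operatorname{dom}\phi\ne\emptyset$ with $\|\nabla\phi(x^k)\|\to\infty$ whenever $\operatorname{int}\operatorname{dom}\phi\ni x^k\to x\in\operatorname{bdry}\operatorname{dom}\phi$) and essentially strictly convex (strictly convex on every convex subset of $\operatorname{dom}\partial\phi$). It is 1-coercive if $\liminf_{\|x\|\to\infty}\phi(x)/\|x\|=\infty$.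 The Fenchel conjugate of $h:\mathbb R^n\to\overline{\mathbb R}$ is $h^*(y)=\sup_{x\in\mathbb R^n}\{\langle x,y\rangle-h(x)\}$. Under the assumptions on $\phi$, $\phi^*$ is finite and differentiable on $\mathbb R^n$, and $D_{\phi^*}(\xi,\eta)=\phi^*(\xi)-\phi^*(\eta)-\langle\nabla\phi^*(\eta),\xi-\eta\rangle$. The canonical extension $\tilde f$ of $f:X\to\overline{\mathbb R}$ equals $f$ on $X$ and $\infty$ on $\mathbb R^n\setminus X$. For $f:S\to\overline{\mathbb R}$, the regular subdifferential at $x$ is $\hat\partial f(x)=\{v\in\mathbb R^n:\liminf_{S\ni z\to x,\,z\ne x}\frac{f(z)-f(x)-\langle v,z-x\rangle}{\|z-x\|}\ge0\}$; the limiting subdifferential is $\partial f(x)=\{v:\exists (x^k,v^k)\in\operatorname{gph}\hat\partial f,\ (x^k,f(x^k),v^k)\to(x,f(x),v)\}$ for $x\in\operatorname{dom}f$ and $\partial f(x)=\emptyset$ otherwise (for convex functions this is the usual convex subdifferential). $\operatorname{gph}\partial f=\{(x,v):v\in\partial f(x)\}$ and $\operatorname{dom}\partial f=\{x:\partial f(x)\ne\emptyset\}$. *)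

(* Defs.v *)
From HB Require Import structures.
From mathcomp Require Import all_boot all_order all_algebra.
From mathcomp Require Import all_classical all_reals all_analysis.

Set Implicit Arguments.
Unset Strict Implicit.
Unset Printing Implicit Defensive.

Import Order.TTheory GRing.Theory Num.Theory.
Import numFieldNormedType.Exports.

Local Open Scope classical_set_scope.
Local Open Scope ring_scope.
Local Open Scope ereal_scope.

(* The library norm on 'rV[R]_n is the sup norm.  It induces the usual topology
   and the usual notion of differentiability; wherever a norm itself is
   mentioned the Euclidean norm [enorm] is used. *)
Definition dotp (R : realType) (n : nat) (u v : 'rV[R]_n) : R :=
  (\sum_(i < n) u 0 i * v 0 i)%R.

Definition enorm (R : realType) (n : nat) (u : 'rV[R]_n) : R :=
  Num.sqrt (dotp u u).

(* A function f : S -> \bar R is represented by a total function together with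
   the set S; the values outside of S are never used. *)

Definition edom (R : realType) (n : nat) (S : set 'rV[R]_n)
    (f : 'rV[R]_n -> \bar R) : set 'rV[R]_n :=
  [set x | S x /\ f x < +oo].

Definition proper_fun (R : realType) (n : nat) (S : set 'rV[R]_n)
    (f : 'rV[R]_n -> \bar R) : Prop :=
  (edom S f !=set0) /\ (forall x, S x -> -oo < f x).

Definition lsc (R : realType) (n : nat) (S : set 'rV[R]_n)
    (f : 'rV[R]_n -> \bar R) : Prop :=
  lower_semicontinuous (f : subspace S -> \bar R).

Definition epigraph (R : realType) (n : nat) (S : set 'rV[R]_n)
    (f : 'rV[R]_n -> \bar R) : set ('rV[R]_n * R^o) :=
  [set p | S p.1 /\ f p.1 <= p.2%:E].

Definition convex_fun (R : realType) (n : nat) (S : set 'rV[R]_n)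
    (f : 'rV[R]_n -> \bar R) : Prop :=
  convex_set (epigraph S f).

Definition canonical_ext (R : realType) (n : nat) (S : set 'rV[R]_n)
    (f : 'rV[R]_n -> \bar R) : 'rV[R]_n -> \bar R :=
  patch (fun=> +oo) S f.

(* Includes that x is interior to S and that f is finite around x. *)
Definition differentiable_at (R : realType) (n : nat) (S : set 'rV[R]_n)
    (f : 'rV[R]_n -> \bar R) (x : 'rV[R]_n) : Prop :=
  (\forall y \near x, S y /\ f y \is a fin_num) /\
  differentiable (fine \o f : 'rV[R]_n -> R) x.

Definition grad (R : realType) (n : nat) (f : 'rV[R]_n -> \bar R)
    (x : 'rV[R]_n) : 'rV[R]_n :=
  \row_(i < n) ('d (fine \o f : 'rV[R]_n -> R) x (delta_mx 0%R i)).

Definition dom_grad (R : realType) (n : nat) (S : set 'rV[R]_n)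
    (f : 'rV[R]_n -> \bar R) : set 'rV[R]_n :=
  [set x | differentiable_at S f x].

Definition fenchel (R : realType) (n : nat) (h : 'rV[R]_n -> \bar R)
    (y : 'rV[R]_n) : \bar R :=
  ereal_sup [set (dotp x y)%:E - h x | x in [set: 'rV[R]_n]].

Definition bregman (R : realType) (n : nat) (g : 'rV[R]_n -> \bar R)
    (xi eta : 'rV[R]_n) : \bar R :=
  g xi - g eta - (dotp (grad g eta) (xi - eta)%R)%:E.

(* The difference quotient only makes sense where f is finite, so the regular
   subdifferential is empty at the other points. *)
Definition regular_subdiff (R : realType) (n : nat) (S : set 'rV[R]_n)
    (f : 'rV[R]_n -> \bar R) (x : 'rV[R]_n) : set 'rV[R]_n :=
  [set v | [/\ S x, f x \is a fin_num &
    0 <= limf_einf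
           (fun z => (f z - f x - (dotp v (z - x)%R)%:E) * ((enorm (z - x)%R)^-1%R)%:E)
           (within S x^')]].

Definition limiting_subdiff (R : realType) (n : nat) (S : set 'rV[R]_n)
    (f : 'rV[R]_n -> \bar R) (x : 'rV[R]_n) : set 'rV[R]_n :=
  [set v | edom S f x /\
    exists u w : nat -> 'rV[R]_n,
      [/\ forall k, regular_subdiff S f (u k) (w k),
          u k @[k --> \oo] --> x,
          f (u k) @[k --> \oo] --> f x &
          w k @[k --> \oo] --> v]].

Definition dom_subdiff (R : realType) (n : nat) (S : set 'rV[R]_n)
    (f : 'rV[R]_n -> \bar R) : set 'rV[R]_n :=
  [set x | limiting_subdiff S f x !=set0].

Definition dgf (R : realType) (n : nat) (phi : 'rV[R]_n -> \bar R) : Prop :=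
  [/\ proper_fun setT phi, lsc setT phi, convex_fun setT phi,
      (edom setT phi)^° !=set0 &
      forall x, (edom setT phi)^° x -> differentiable_at setT phi x].

Definition essentially_smooth (R : realType) (n : nat) (S : set 'rV[R]_n)
    (f : 'rV[R]_n -> \bar R) : Prop :=
  [/\ (edom S f)^° !=set0,
      forall x, (edom S f)^° x -> differentiable_at S f x &
      forall (u : nat -> 'rV[R]_n) (x : 'rV[R]_n),
        (forall k, (edom S f)^° (u k)) ->
        u k @[k --> \oo] --> x ->
        (closure (edom S f) `\` (edom S f)^°) x ->
        enorm (grad f (u k)) @[k --> \oo] --> +oo%R].

Definition strictly_convex_on (R : realType) (n : nat) (C : set 'rV[R]_n)
    (f : 'rV[R]_n -> \bar R) : Prop :=
  forall (x y : 'rV[R]_n) (t : R), C x -> C y -> x <> y -> (0 < t < 1)%R ->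
    f (t *: x + (1 - t) *: y)%R < t%:E * f x + (1 - t)%R%:E * f y.

Definition essentially_strictly_convex (R : realType) (n : nat)
    (phi : 'rV[R]_n -> \bar R) : Prop :=
  forall C : set 'rV[R]_n, convex_set C -> C `<=` dom_subdiff setT phi ->
    strictly_convex_on C phi.

Definition legendre (R : realType) (n : nat) (phi : 'rV[R]_n -> \bar R) : Prop :=
  essentially_smooth setT phi /\ essentially_strictly_convex phi.

(* The filter of "||x|| -> oo". *)
Definition enorm_oo (R : realType) (n : nat) : set_system 'rV[R]_n :=
  filter_from [set: R] (fun r : R => [set x : 'rV[R]_n | (r < enorm x)%R]).

Definition one_coercive (R : realType) (n : nat) (phi : 'rV[R]_n -> \bar R) : Prop :=
  limf_einf (fun x => phi x * ((enorm x)^-1%R)%:E) (@enorm_oo R n) = +oo.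

Definition diff_on_int (R : realType) (n : nat) (X : set 'rV[R]_n)
    (f : 'rV[R]_n -> \bar R) : Prop :=
  forall x, X^° x -> differentiable_at X f x.

Definition B_smooth (R : realType) (n : nat) (phi f : 'rV[R]_n -> \bar R) : Prop :=
  let X := edom setT phi in
  diff_on_int X f /\ convex_fun X^° (fun x => phi x - f x).

Definition extended_B_cocoercive (R : realType) (n : nat)
    (phi f : 'rV[R]_n -> \bar R) : Prop :=
  let X := edom setT phi in
  diff_on_int X f /\
  forall xb x xi : 'rV[R]_n, X^° xb -> limiting_subdiff X f x xi ->
    f xb - f x - (dotp xi (xb - x)%R)%:E >=
    bregman (fenchel phi) (grad phi xb - (grad f xb - xi))%R (grad phi xb).

Definition B_cocoercive (R : realType) (n : nat)
    (phi f : 'rV[R]_n -> \bar R) : Prop :=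
  let X := edom setT phi in
  diff_on_int X f /\
  forall x xb : 'rV[R]_n, X^° x -> X^° xb ->
    f xb - f x - (dotp (grad f x) (xb - x)%R)%:E >=
    bregman (fenchel phi) (grad phi xb - (grad f xb - grad f x))%R (grad phi xb).

Definition conj_aniso_strongly_convex (R : realType) (n : nat)
    (phi f : 'rV[R]_n -> \bar R) : Prop :=
  let X := edom setT phi in
  let fs := fenchel (canonical_ext X f) in
  forall xi xib xb : 'rV[R]_n, limiting_subdiff setT fs xib xb -> X^° xb ->
    fs xi >= fs xib + fenchel phi (xi - xib + grad phi xb)%R
             - fenchel phi (grad phi xb).

Definition conj_representation (R : realType) (n : nat)
    (phi f : 'rV[R]_n -> \bar R) : Prop :=
  let X := edom setT phi in
  let fs := fenchel (canonical_ext X f) in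
  let h := fun eta : 'rV[R]_n =>
    ereal_sup [set fenchel phi (xi - eta)%R - fs xi | xi in [set: 'rV[R]_n]] in
  edom X f = X /\ forall x, X^° x -> f x = phi x - fenchel h (- x)%R.

(* Main.v *)
Require Import Defs.
From HB Require Import structures.
From mathcomp Require Import all_boot all_order all_algebra.
From mathcomp Require Import all_classical all_reals all_analysis.
From mathcomp Require Import ring lra.

(** Write [X] for the domain of [phi], [f*] for the conjugate of the extension of
    [f] by [+oo], and [phi*] for the conjugate of [phi].  Everything revolves
    around the descent inequality at an interior point [x] with slope [xi],
[[
      f z <= phi z + f x - phi x - <grad phi x - xi, z - x>     for all z,
]]
    that is, [f] lies below the copy of [phi] tilted and lifted so as to touch
    [f] at [x] with slope [xi].

    For [xi = grad f x] it is the gradient inequality of [phi - f] at [x], so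
    that B-smoothness is the descent inequality at all interior points
    ([B_smooth_descent], [descent_convex]); it passes from the interior of [X]
    to [X] along segments, by convexity of [phi] and semicontinuity of [f]
    ([descent_closure]).  Taking conjugates of both sides turns it into
[[
      phi* (eta - xi + grad phi x) <= f* eta + constant         for all eta
]]
    ([descent_conj]).  The anisotropic strong convexity of [f*] is this
    inequality, because interior subgradients of [f*] are gradients of [f]; at
    points [eta] of the range of the subdifferential of [f], where [f*] is given
    by the Fenchel-Young equality, it is the extended cocoercivity, because
    [grad phi*] inverts [grad phi]; and it is what identifies the conjugate of
    the function [h] at [- x] with [phi x - f x].

    In the other direction, the Fenchel-Young inequality for [phi] at [x]
    alone turns cocoercivity between interior points [x] and [xb] into the
    descent inequality at [xb] ([cocoercive_B_smooth]).  Strong convexity of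
    [f*] first says nothing about differentiability of [f], not even about its
    finiteness.  Since [f] is the supremum of its affine minorants at interior
    points, the inequality between conjugates can be conjugated back
    ([conj_descent_descent]); applied at a single interior subgradient, it
    bounds [f] by [phi] plus an affine function, hence locally, and this
    provides subgradients at all interior points.  The descent inequality at
    each of them then squeezes [f] between two functions with the same
    first-order expansion ([aniso_B_smooth]).  In the representation through
    [h], [phi - f] is a conjugate, hence convex, and differentiability is
    inherited by both terms of a sum of convex functions
    ([split_differentiable]).

    The convex analysis this rests on is derived from two facts: the projection
    onto a closed convex set in [R^n * R], applied to epigraphs, yields affine
    minorants and subgradients ([affine_minorant], [subgradient_exists]); and
    strict convexity makes [phi] grow linearly above its tangents away from the
    contact point, whence the gradient of [phi*] ([grad_fenchel]).  Finally, a
    convex function has bounded gradients along a segment ending at a point with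
    a subgradient, so essential smoothness confines subgradients to the interior
    ([essentially_smooth_dom_subdiff]). *)

Set Implicit Arguments.
Unset Strict Implicit.
Unset Printing Implicit Defensive.

Import Order.TTheory GRing.Theory Num.Theory.
Import numFieldNormedType.Exports.

Local Open Scope classical_set_scope.
Local Open Scope ring_scope.

(** * Inner products and first-order expansions *)

Section Vectors.
Context {R : realType} {n : nat}.
Implicit Types (u v w x y z : 'rV[R]_n) (a b c t : R).

Lemma dotpC u v : dotp u v = dotp v u.
Proof. by apply: eq_bigr => i _; rewrite mulrC. Qed.

Lemma dotpDl u v w : dotp (u + v) w = dotp u w + dotp v w.
Proof. by rewrite -big_split; apply: eq_bigr => i _; rewrite mxE mulrDl. Qed.

Lemma dotpZl a u w : dotp (a *: u) w = a * dotp u w.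
Proof. by rewrite mulr_sumr; apply: eq_bigr => i _; rewrite mxE mulrA. Qed.

Lemma dotpNl u w : dotp (- u) w = - dotp u w.
Proof. by rewrite -scaleN1r dotpZl mulN1r. Qed.

Lemma dotpDr u v w : dotp w (u + v) = dotp w u + dotp w v.
Proof. by rewrite dotpC dotpDl !(dotpC w). Qed.

Lemma dotpZr a u w : dotp w (a *: u) = a * dotp w u.
Proof. by rewrite dotpC dotpZl (dotpC w). Qed.

Lemma dotpNr u w : dotp w (- u) = - dotp w u.
Proof. by rewrite dotpC dotpNl (dotpC w). Qed.

Lemma dotp0l u : dotp 0 u = 0.
Proof. by rewrite -(scale0r 0) dotpZl mul0r. Qed.

Lemma dotp0r u : dotp u 0 = 0.
Proof. by rewrite dotpC dotp0l. Qed.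

Definition dotpE := (dotpDl, dotpDr, dotpNl, dotpNr, dotpZl, dotpZr, dotp0l, dotp0r).

Lemma dotp_ge0 u : 0 <= dotp u u.
Proof. by apply: sumr_ge0 => i _; rewrite -expr2 sqr_ge0. Qed.

Lemma coord_le_norm u i : `|u 0 i| <= `|u|.
Proof. by rewrite [leRHS]/Num.norm /= mx_normrE; exact: (le_bigmax _ _ (0, i)). Qed.

Lemma dotp_le_norm u v : `|dotp u v| <= n%:R * (`|u| * `|v|).
Proof.
apply: le_trans (ler_norm_sum _ _ _) _.
rewrite -[n in n%:R]card_ord -sumr_const mulr_suml; apply: ler_sum => i _.
by rewrite mul1r normrM ler_pM // coord_le_norm.
Qed.

Lemma sqr_coord_le_dotp u i : (u 0 i) ^+ 2 <= dotp u u.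
Proof.
rewrite /dotp (bigD1 i) //= -expr2 lerDl.
by apply: sumr_ge0 => j _; rewrite -expr2 sqr_ge0.
Qed.

Lemma norm_le_enorm u : `|u| <= enorm u.
Proof.
rewrite {1}/Num.norm /= mx_normrE; apply/bigmax_leP; split; first exact: sqrtr_ge0.
move=> [i j] _ /=; rewrite ord1 -sqrtr_sqr; apply: ler_wsqrtr.
exact: sqr_coord_le_dotp.
Qed.

Lemma sqr_enorm u : enorm u ^+ 2 = dotp u u.
Proof. by rewrite sqr_sqrtr // dotp_ge0. Qed.

Lemma enorm_gt0 u : u != 0 -> 0 < enorm u.
Proof. by move=> u0; apply: lt_le_trans (norm_le_enorm u); rewrite normr_gt0. Qed.

Lemma enormZ a u : enorm (a *: u) = `|a| * enorm u.
Proof.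
rewrite /enorm !dotpE mulrA -expr2 sqrtrM ?sqr_ge0 // sqrtr_sqr //.
Qed.

Lemma dotp_eq0 u : dotp u u = 0 -> u = 0.
Proof.
move=> u0; apply/eqP; apply: contraTT isT => /enorm_gt0.
by rewrite /enorm u0 sqrtr0 ltxx.
Qed.

Lemma dotp_le0 u : dotp u u <= 0 -> u = 0.
Proof. by move=> u0; apply/dotp_eq0/le_anti; rewrite u0 dotp_ge0. Qed.

Lemma dotp_cvg (T : Type) (F : set_system T) {FF : Filter F}
    (p q : T -> 'rV[R]_n) u v :
  p @ F --> u -> q @ F --> v -> dotp (p k) (q k) @[k --> F] --> dotp u v.
Proof.
move=> pu qv; apply: cvg_big; first exact: add_continuous.
move=> i _; apply: cvgM.
  exact: (cvg_comp p (fun w : 'rV_n => w 0 i) pu (@coord_continuous _ _ _ 0 i u)).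
exact: (cvg_comp q (fun w : 'rV_n => w 0 i) qv (@coord_continuous _ _ _ 0 i v)).
Qed.

(** Differentiability at [x] with gradient [v], as an inequality: the form in
    which convexity arguments produce and consume it. *)
Definition first_order (F : 'rV[R]_n -> R) x v :=
  forall e : R, 0 < e ->
    \forall z \near x, `|F z - F x - dotp v (z - x)| <= e * `|z - x|.

Lemma near_dist_le x (d : R) : 0 < d -> \forall z \near x, `|z - x| <= d.
Proof.
move=> d0; apply/(nbhs_normP x); exists d => //= z /=.
by rewrite distrC => /ltW.
Qed.

Lemma first_order_continuous F x v : first_order F x v ->
  forall e, 0 < e -> \forall z \near x, `|F z - F x| <= e.
Proof.
move=> Fxv e e0; pose c := 1 + n%:R * `|v|.
have c0 : 0 < c by rewrite ltr_pwDl // mulr_ge0.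
have := @near_dist_le x (e / c) (divr_gt0 e0 c0).
have := Fxv 1 ltr01; apply: filterS2 => z le1 le2.
have le3 := dotp_le_norm v (z - x).
have le4 : `|F z - F x| <= c * `|z - x|.
  rewrite -[F z - F x](subrK (dotp v (z - x))).
  by apply: le_trans (ler_normD _ _) _; rewrite /c; nra.
by apply: le_trans le4 _; rewrite mulrC -ler_pdivlMr.
Qed.

End Vectors.

Section FirstOrder.
Context {R : realType} {n : nat}.
Implicit Types (F : 'rV[R]_n -> R) (u v x : 'rV[R]_n).

Lemma dotp_linear v : linear (dotp v : 'rV[R]_n -> R).
Proof. by move=> a x y; rewrite !dotpE. Qed.

HB.instance Definition _ v :=
  GRing.isLinear.Build R 'rV[R]_n R _ (dotp v) (dotp_linear v).

Lemma dotp_continuous v : continuous (dotp v : 'rV[R]_n -> R).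
Proof. by move=> x; apply: (@dotp_cvg _ _ _ (nbhs x)) (cvg_cst _) (@cvg_id _ _). Qed.

Lemma first_order_diff F x v : first_order F x v ->
  differentiable F x /\ forall i, 'd F x (delta_mx 0%R i) = v 0 i.
Proof.
move=> Fxv; pose l : {linear 'rV[R]_n -> R} := dotp v.
have H : forall e, 0 < e -> \forall z \near (0 : 'rV[R]_n),
    `|(F \o shift x - (cst (F x) + l)) z| <= e * `|z|.
  move=> e e0; have := Fxv e e0; rewrite (near_shift 0) /=.
  apply: filterS => z.
  by rewrite !fctE /= subr0 addrK opprD addrA.
have dE : 'd F x = dotp v :> (_ -> _).
  apply: (@diff_unique _ _ _ _ l); first exact: dotp_continuous.
  exact/eqaddoP.
split.
  apply/diff_locallyP; split; first by rewrite dE; exact: dotp_continuous.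
  by rewrite dE; exact/eqaddoP.
move=> i; rewrite dE /dotp (bigD1 i) //= mxE !eqxx mulr1 big1 ?addr0 // => j ji.
by rewrite mxE (negbTE ji) andbF mulr0.
Qed.

Lemma diff_first_order F x : differentiable F x ->
  first_order F x (\row_i 'd F x (delta_mx 0%R i)).
Proof.
move=> dF e e0.
have dE u : dotp (\row_i 'd F x (delta_mx 0%R i)) u = 'd F x u.
  rewrite [in RHS](row_sum_delta u) linear_sum; apply: eq_bigr => i _.
  by rewrite linearZ mxE mulrC.
have /diff_locally /eqaddoP /(_ e e0) := dF.
rewrite near_simpl (near_shift x) /= sub0r; apply: filterS => z.
by rewrite dE !fctE /= subrK opprD addrA.
Qed.

End FirstOrder.

(** * Convex functions and subgradients *)

Section Convexity.
Context {R : realType} {n : nat}.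
Implicit Types (S A : set 'rV[R]_n) (f g : 'rV[R]_n -> \bar R).
Implicit Types (u v w x y z : 'rV[R]_n) (a b c t r : R).

Lemma nbhs_dist_leP x A :
  nbhs x A <-> exists2 r, 0 < r & forall z, `|z - x| <= r -> A z.
Proof.
split=> [/(nbhs_normP x)[r /= r0 rA]|[r r0 rA]].
  exists (r / 2); first by rewrite divr_gt0.
  by move=> z zr; apply: rA => /=; rewrite distrC; lra.
by apply: filterS (near_dist_le x r0) => z; exact: rA.
Qed.

Lemma convex_funP S f : convex_fun S f <->
  forall x y a b t, S x -> S y -> (f x <= a%:E)%E -> (f y <= b%:E)%E ->
    0 <= t <= 1 -> S (x + t *: (y - x)) /\
    (f (x + t *: (y - x))%R <= (a + t * (b - a))%R%:E)%E.
Proof.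
have segE x y t : t *: y + (1 - t) *: x = x + t *: (y - x).
  by rewrite scalerBl scale1r scalerBr addrC -addrA (addrC (- _)).
have segE' a b t : t * b + (1 - t) * a = a + t * (b - a) by ring.
split=> [cf x y a b t Sx Sy fa fb /andP[t0 t1]|cf].
  have := cf (y, b) (x, a) (Itv01 t0 t1).
  rewrite !inE => /(_ (conj Sy fb) (conj Sx fa)) [].
  by rewrite /= segE => ? ; rewrite -segE'.
move=> [y b] [x a] t; rewrite !inE => -[Sy fb] [Sx fa].
have /(_ t%:num) := cf x y a b _ Sx Sy fa fb.
by rewrite ge0 le1 -segE -segE' => /(_ isT).
Qed.

(** A bound on a value of a possibly infinite convex function is best read off
    its epigraph: it suffices to bound every real above that value. *)
Lemma le_ereal_of_real c (e : \bar R) :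
  (forall a, (e <= a%:E)%E -> c <= a) -> (c%:E <= e)%E.
Proof.
case: e => [r||] H; first by rewrite lee_fin; exact: H.
  exact: leey.
by have := H (c - 1); rewrite leNye => /(_ isT); rewrite lerBrDr gerDl ler10.
Qed.

Definition subgradient S f x v :=
  [/\ S x, f x \is a fin_num &
      forall z, S z -> ((fine (f x) + dotp v (z - x))%R%:E <= f z)%E].

Lemma differentiable_first_order S f x : differentiable_at S f x ->
  first_order (fine \o f) x (grad f x).
Proof. by case=> _; exact: diff_first_order. Qed.

Lemma first_order_differentiable S f x v :
  (\forall y \near x, S y /\ f y \is a fin_num) -> first_order (fine \o f) x v ->
  differentiable_at S f x /\ grad f x = v.
Proof.
move=> near_fin /first_order_diff[df dE]; split; first by [].
by apply/rowP => i; rewrite mxE.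
Qed.

Lemma differentiable_at_fin S f x : differentiable_at S f x ->
  S x /\ f x \is a fin_num.
Proof. by case=> /nbhs_singleton. Qed.

(** A chord of a convex function stays above the function, hence above its
    first-order expansion at the near end of the chord. *)
Lemma first_order_subgradient S f x v : convex_fun S f -> S x ->
  f x \is a fin_num ->
  first_order (fine \o f) x v -> (\forall y \near x, f y \is a fin_num) ->
  subgradient S f x v.
Proof.
move=> /convex_funP cf Sx fx dv nearf; split=> // z Sz.
apply: le_ereal_of_real => a fza; rewrite leNgt; apply/negP => lt_a.
have [zx|zx] := eqVneq z x.
  by move: fza lt_a; rewrite zx subrr dotp0r addr0 -{1}(fineK fx) lee_fin ltNge => ->.
have N0 : 0 < `|z - x| by rewrite normr_gt0 subr_eq0.
(* [d] is how far the chord would start below the tangent; the error allowed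
   in the expansion is half of it. *)
pose d := fine (f x) + dotp v (z - x) - a; have d0 : 0 < d by rewrite subr_gt0.
have e0 : 0 < d / (2 * `|z - x|) by rewrite divr_gt0 // mulr_gt0.
have [r r0 H] : exists2 r, 0 < r & forall y, `|y - x| <= r ->
    f y \is a fin_num /\
    `|fine (f y) - fine (f x) - dotp v (y - x)| <= d / (2 * `|z - x|) * `|y - x|.
  by apply/nbhs_dist_leP; apply: filterS2 nearf (dv _ e0).
pose t := Num.min 1 (r / `|z - x|).
have t0 : 0 < t by rewrite lt_min ltr01 divr_gt0.
have t1 : t <= 1 by rewrite ge_min lexx.
have tr : t * `|z - x| <= r by rewrite -ler_pdivlMr // ge_min lexx orbT.
have := H (x + t *: (z - x)); rewrite (addrC x) addrK normrZ (ger0_norm (ltW t0)).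
rewrite addrC => /(_ tr)[fin /ler_normlP[+ _]].
have fxle : (f x <= (fine (f x))%:E)%E by rewrite fineK.
have t01 : 0 <= t <= 1 by rewrite ltW.
have [_] := cf x z (fine (f x)) a t Sx Sz fxle fza t01.
rewrite -(fineK fin) lee_fin => le1.
rewrite dotpZr.
have -> : d / (2 * `|z - x|) * (t * `|z - x|) = t * (d / 2).
  by field; rewrite gt_eqF.
move=> le2; have : t * d <= t * (d / 2) by rewrite {1}/d; lra.
by rewrite ler_pM2l //; lra.
Qed.

Lemma grad_subgradient S f x : convex_fun S f -> differentiable_at S f x ->
  subgradient S f x (grad f x).
Proof.
move=> cf df; have [Sx fx] := differentiable_at_fin df.
apply: first_order_subgradient => //; first exact: differentiable_first_order df.
by case: df => + _; apply: filterS => y [].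
Qed.

(** The subgradient inequality already is the lower half of the first-order
    expansion. *)
Lemma subgradient_squeeze S f x v : subgradient S f x v ->
  (forall e, 0 < e -> \forall z \near x, S z /\
     (f z <= (fine (f x) + dotp v (z - x) + e * `|z - x|)%R%:E)%E) ->
  differentiable_at S f x /\ grad f x = v.
Proof.
move=> [Sx fx H] up; apply: first_order_differentiable.
  apply: filterS (up 1 ltr01) => z [Sz fz]; split=> //.
  have := H z Sz; move: fz; by case: (f z).
move=> e e0; apply: filterS (up e e0) => z [Sz fz] /=.
have := H z Sz; move: fz; case: (f z) => [c| |] //=; rewrite !lee_fin => fz le.
by rewrite ler_norml; apply/andP; split; last lra; have := normr_ge0 (z - x); nra.
Qed.

End Convexity.

(** * Interiors of convex sets and the regular subdifferential *)

Section Subdifferential.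
Context {R : realType} {n : nat}.
Implicit Types (S A : set 'rV[R]_n) (f g : 'rV[R]_n -> \bar R).
Implicit Types (u v w x y z : 'rV[R]_n) (a b c t r : R).

Definition segment_closed A :=
  forall x y t, A x -> A y -> 0 <= t <= 1 -> A (x + t *: (y - x)).

Lemma edom_convex S f : convex_fun S f -> segment_closed (edom S f).
Proof.
move=> /convex_funP cf x y t [Sx fx] [Sy fy] t01.
have [a fa] : exists a, (f x <= a%:E)%E.
  by case: (f x) fx => [a _|//|_]; [exists a|exists 0; exact: leNye].
have [b fb] : exists b, (f y <= b%:E)%E.
  by case: (f y) fy => [b _|//|_]; [exists b|exists 0; exact: leNye].
have [Sxy fxy] := cf x y a b t Sx Sy fa fb t01.
by split=> //; exact: le_lt_trans fxy (ltry _).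
Qed.

(** A homothety of centre [y] maps a ball around [x] to a ball around a point of
    the segment, and convexity keeps it inside [A]. *)
Lemma interior_segment A x y t : segment_closed A -> A^° x -> A y ->
  0 <= t < 1 -> A^° (x + t *: (y - x)).
Proof.
move=> cA /nbhs_dist_leP[r r0 rA] Ay /andP[t0 t1]; apply/nbhs_dist_leP.
have s0 : 0 < 1 - t by rewrite subr_gt0.
exists ((1 - t) * r); first by rewrite mulr_gt0.
move=> z zr; pose w := x + (1 - t)^-1 *: (z - (x + t *: (y - x))).
have Aw : A w.
  apply: rA; rewrite /w addrC addKr normrZ ger0_norm ?invr_ge0 ?(ltW s0) //.
  by rewrite ler_pdivrMl.
have -> : z = w + t *: (y - w).
  by apply/rowP => i; rewrite !mxE; field; rewrite gt_eqF.
by apply: cA => //; rewrite t0 ltW.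
Qed.

Lemma interior_convex A : segment_closed A -> segment_closed A^°.
Proof.
move=> cA x y t Ax Ay /andP[t0]; rewrite le_eqVlt => /predU1P[->|t1].
  by rewrite scale1r subrKC.
by apply: interior_segment => //; [exact: interior_subset Ay | rewrite t0].
Qed.

(** The difference quotient along a segment issued from [x] is constantly at
    most the slope of the chord, so a chord below the candidate tangent would
    keep the lower limit negative. *)
Lemma regular_subdiff_subgradient S f x v :
  convex_fun S f -> regular_subdiff S f x v -> subgradient S f x v.
Proof.
move=> /convex_funP cf [Sx fx liminf]; split=> // z Sz.
apply: le_ereal_of_real => a fza; rewrite leNgt; apply/negP => lt_a.
have zx : z != x.
  apply: contraTneq lt_a => zx; rewrite -leNgt zx subrr dotp0r addr0.
  by rewrite -lee_fin fineK // -zx.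
have nz : 0 < enorm (z - x) by rewrite enorm_gt0 // subr_eq0.
have N0 : 0 < `|z - x| by rewrite normr_gt0 subr_eq0.
pose q := (a - fine (f x) - dotp v (z - x)) / enorm (z - x).
have q0 : q < 0 by rewrite ltr_pdivrMr // mul0r; lra.
move: liminf; rewrite limf_einfE; apply/negP; rewrite -ltNge.
apply: (@le_lt_trans _ _ q%:E); last by rewrite lte_fin.
apply: ge_ereal_sup => _ [V /nbhs_dist_leP[r r0 rV] <-].
pose t := Num.min 1 (r / `|z - x|).
have t0 : 0 < t by rewrite lt_min ltr01 divr_gt0.
have t1 : t <= 1 by rewrite ge_min lexx.
have tr : t * `|z - x| <= r by rewrite -ler_pdivlMr // ge_min lexx orbT.
have fxle : (f x <= (fine (f x))%:E)%E by rewrite fineK.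
have t01 : 0 <= t <= 1 by rewrite ltW.
have [St ft] := cf x z (fine (f x)) a t Sx Sz fxle fza t01.
pose y := x + t *: (z - x).
have yx : y - x = t *: (z - x) by rewrite /y addrC addKr.
have Vy : V y.
  apply: rV => //; first by rewrite yx normrZ gtr0_norm.
  apply/eqP => yx0; move/eqP: yx.
  by rewrite yx0 subrr eq_sym scaler_eq0 gt_eqF // subr_eq0 (negbTE zx).
apply: ge_ereal_inf.
exists ((f y - f x - (dotp v (y - x))%:E) * ((enorm (y - x))^-1)%:E)%E.
  by exists y.
rewrite yx enormZ gtr0_norm // dotpZr -(fineK fx).
have qE : (fine (f x) + t * (a - fine (f x)) - fine (f x) - t * dotp v (z - x)) *
    (t * enorm (z - x))^-1 = q.
  by rewrite /q; field; rewrite !gt_eqF.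
rewrite -qE !EFinM !EFinB lee_wpmul2r //.
  by rewrite lee_fin invr_ge0 mulr_ge0 // ltW.
by rewrite !leeB.
Qed.

Lemma subgradient_limiting_subdiff S f x v :
  subgradient S f x v -> limiting_subdiff S f x v.
Proof.
move=> [Sx fx H]; split; first by split=> //; case: (f x) fx => // r; rewrite ltry.
exists (fun=> x), (fun=> v); split; [|exact: cvg_cst..].
move=> _; split=> //; rewrite limf_einfE.
apply: le_ereal_sup_tmp; exists (ereal_inf ((fun z => ((f z - f x - (dotp v (z - x))%:E) *
    ((enorm (z - x))^-1)%:E)%E) @` (S `\ x))).
  exists (S `\ x) => //; rewrite /within /= near_withinE; near=> z => zx Sz.
  by split=> // zx'; move: zx; rewrite zx' eqxx.
apply: le_ereal_inf_tmp => _ [z [Sz zx] <-].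
have := H z Sz; rewrite -(fineK fx); case: (f z) => [c| |] //.
  rewrite -!EFinB -EFinM !lee_fin => le1.
  by rewrite mulr_ge0 ?invr_ge0 ?sqrtr_ge0 //; lra.
by rewrite /= gt0_mulye // lte_fin invr_gt0 enorm_gt0 // subr_eq0; exact/eqP.
Unshelve. all: by end_near.
Qed.


End Subdifferential.


Section LimitingSubdifferential.
Context {R : realType} {n : nat}.
Implicit Types (S A : set 'rV[R]_n) (f g h : 'rV[R]_n -> \bar R).
Implicit Types (u v w x y z : 'rV[R]_n) (a b c t r : R).

(** Subgradient inequalities survive limits of points, values and slopes. *)
Lemma limiting_subdiffP S f x v : convex_fun S f ->
  (forall z, S z -> (-oo < f z)%E) ->
  limiting_subdiff S f x v <-> subgradient S f x v.
Proof.
move=> cf fNy; split; last exact: subgradient_limiting_subdiff.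
move=> [[Sx fxy] [u [w [uw ux fu wv]]]].
have fx : f x \is a fin_num by rewrite fin_numElt fNy.
have sub k := regular_subdiff_subgradient cf (uw k).
split=> // z Sz; apply: le_ereal_of_real => a fza.
have fineu : fine (f (u k)) @[k --> \oo] --> fine (f x).
  by apply: fine_cvg; rewrite fineK.
have lhs : fine (f (u k)) + dotp (w k) (z - u k) @[k --> \oo] -->
    fine (f x) + dotp v (z - x).
  apply: cvgD => //; apply: dotp_cvg => //.
  by apply: cvgB => //; exact: cvg_cst.
apply: (@ler_cvg_to _ _ _ _ _ (fun=> a) _ _ lhs (cvg_cst a)).
apply: nearW => k; rewrite -lee_fin; apply: le_trans fza.
by have [_ _] := sub k; exact.
Qed.
End LimitingSubdifferential.

Section Fenchel.
Context {R : realType} {n : nat}.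
Implicit Types (S A : set 'rV[R]_n) (f g h : 'rV[R]_n -> \bar R).
Implicit Types (u v w x y z : 'rV[R]_n) (a b c t r : R).
Local Open Scope ereal_scope.

Lemma fenchel_ge h x y : (dotp x y)%:E - h x <= fenchel h y.
Proof. by apply: ereal_sup_ubound; exists x. Qed.

Lemma fenchel_le h y (e : \bar R) :
  (forall x, (dotp x y)%:E - h x <= e) -> fenchel h y <= e.
Proof. by move=> H; apply: ge_ereal_sup => _ [x _ <-]. Qed.

(** Conjugates are suprema of affine functions, whatever [h] is. *)
Lemma fenchel_convex h : convex_fun setT (fenchel h).
Proof.
apply/convex_funP => x y a b t _ _ fa fb /andP[t0 t1]; split=> //.
apply: fenchel_le => z.
have := le_trans (fenchel_ge h z x) fa; have := le_trans (fenchel_ge h z y) fb.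
case: (h z) => [c| |] //=; rewrite ?leNye //.
rewrite -!EFinB !lee_fin !dotpE => lb la.
by nra.
Qed.

Lemma canonical_extE S f x : S x -> canonical_ext S f x = f x.
Proof. by move=> Sx; rewrite /canonical_ext patchT ?inE. Qed.

Lemma canonical_ext_out S f x : ~ S x -> canonical_ext S f x = +oo.
Proof. by move=> Sx; rewrite /canonical_ext patchC // inE. Qed.

Lemma canonical_extT f : canonical_ext setT f = f.
Proof. by apply/funext => x; rewrite canonical_extE. Qed.

Lemma fenchel_ext_ge S f x y : S x ->
  (dotp x y)%:E - f x <= fenchel (canonical_ext S f) y.
Proof. by move=> Sx; rewrite -(canonical_extE f Sx); exact: fenchel_ge. Qed.

Lemma fenchel_ext_le S f y c :
  (forall x, S x -> (dotp x y - c)%R%:E <= f x) ->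
  fenchel (canonical_ext S f) y <= c%:E.
Proof.
move=> H; apply: fenchel_le => x; have [Sx|Sx] := pselect (S x).
  rewrite canonical_extE //; have := H x Sx; case: (f x) => [b| |].
  - by rewrite -EFinB !lee_fin; lra.
  - by rewrite /= leNye.
  - by rewrite leeNy_eq.
by rewrite canonical_ext_out //= leNye.
Qed.

Lemma fenchel_ext_gtNy S f y : edom S f !=set0 -> (forall z, S z -> -oo < f z) ->
  -oo < fenchel (canonical_ext S f) y.
Proof.
move=> [x [Sx fx]] fNy; apply: lt_le_trans (fenchel_ext_ge f y Sx).
by have := fNy x Sx; case: (f x) fx => // r _ _; rewrite -EFinB ltNyr.
Qed.

(** The subgradient inequality says that [x] attains the supremum that defines
    the conjugate at [v]. *)
Lemma fenchel_subgradient S f x v : subgradient S f x v ->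
  fenchel (canonical_ext S f) v = (dotp x v - fine (f x))%:E.
Proof.
move=> [Sx fx H]; apply/eqP; rewrite eq_le; apply/andP; split.
  apply: fenchel_ext_le => z Sz; apply: le_trans (H z Sz); rewrite lee_fin.
  by rewrite !dotpE !(dotpC v); lra.
by rewrite EFinB fineK //; exact: fenchel_ext_ge.
Qed.

Lemma subgradient_fenchel S f x v : subgradient S f x v ->
  subgradient setT (fenchel (canonical_ext S f)) v x.
Proof.
move=> sub; have fE := fenchel_subgradient sub; have [Sx fx H] := sub.
split=> //; first by rewrite fE.
move=> w _; apply: le_trans (fenchel_ext_ge f w Sx).
by rewrite fE -{2}(fineK fx) -EFinB lee_fin /= !dotpE; lra.
Qed.

End Fenchel.

(** * Projection onto a convex set *)

Section Projection.
Context {R : realType} {n : nat}.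
Implicit Types (p q : ('rV[R]_n * R)%type) (u v w x y z : 'rV[R]_n) (a b c t r : R).

Definition sqdist p q := dotp (p.1 - q.1) (p.1 - q.1) + (p.2 - q.2) ^+ 2.

Lemma sqdist_continuous p : continuous (sqdist p).
Proof.
move=> q; apply: cvgD.
  have H : p.1 - q'.1 @[q' --> q] --> p.1 - q.1.
    by apply: cvgB; [exact: cvg_cst|exact: cvg_fst].
  exact: (dotp_cvg H H).
have H : p.2 - q'.2 @[q' --> q] --> p.2 - q.2.
  by apply: cvgB; [exact: cvg_cst|exact: cvg_snd].
exact: (cvgM H H).
Qed.

Lemma ball_compact x r : compact [set v : 'rV[R]_n | `|x - v| <= r].
Proof.
apply: bounded_closed_compact; last exact: closed_closed_ball_.
exists (r + `|x|); split; first exact: num_real.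
move=> M rM v /= vr; rewrite -(subrK x v); apply: le_trans (ler_normD _ _) _.
by rewrite distrC; lra.
Qed.

Lemma sqdist_ge0 p q : 0 <= sqdist p q.
Proof. by rewrite addr_ge0 ?dotp_ge0 ?sqr_ge0. Qed.

Lemma closure_segment (C : set ('rV[R]_n * R)) p q t :
  (forall p q t, C p -> C q -> 0 <= t <= 1 ->
     C (p.1 + t *: (q.1 - p.1), p.2 + t * (q.2 - p.2))) ->
  closure C p -> C q -> 0 <= t <= 1 ->
  closure C (p.1 + t *: (q.1 - p.1), p.2 + t * (q.2 - p.2)).
Proof.
move=> cC Cp Cq t01 V Vp.
pose g p' : 'rV[R]_n * R := (p'.1 + t *: (q.1 - p'.1), p'.2 + t * (q.2 - p'.2)).
have g1 : (p'.1 + t *: (q.1 - p'.1)) @[p' --> p] --> p.1 + t *: (q.1 - p.1).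
  apply: cvgD; first exact: cvg_fst.
  by apply: cvgZ; [exact: cvg_cst|apply: cvgB; [exact: cvg_cst|exact: cvg_fst]].
have g2 : (p'.2 + t * (q.2 - p'.2)) @[p' --> p] --> p.2 + t * (q.2 - p.2).
  apply: cvgD; first exact: cvg_snd.
  by apply: cvgM; [exact: cvg_cst|apply: cvgB; [exact: cvg_cst|exact: cvg_snd]].
have gc : g @ p --> g p.
  by apply: (cvg_pair g1 g2); exact: nbhs_filter.
have [p' [Cp' Vp']] := Cp _ (gc _ Vp).
by exists (g p'); split=> //; exact: cC.
Qed.

(** The projection of a point onto the closure of a convex set: by minimality
    of the distance, the segment from the projection to any point of the set
    starts in a direction that does not decrease the distance. *)
Lemma convex_projection (C : set ('rV[R]_n * R)) p0 :
  (forall p q t, C p -> C q -> 0 <= t <= 1 ->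
     C (p.1 + t *: (q.1 - p.1), p.2 + t * (q.2 - p.2))) ->
  C !=set0 ->
  exists p, [/\ closure C p,
    forall q, C q -> dotp (p0.1 - p.1) (q.1 - p.1) + (p0.2 - p.2) * (q.2 - p.2) <= 0 &
    forall q, C q -> sqdist p0 p <= sqdist p0 q].
Proof.
move=> cC [q0 Cq0].
(* With [d] the distance from [p0] to [q0], [rho = d ^+ 2 + 1] exceeds [d]. *)
pose rho := sqdist p0 q0 + 1.
have rho1 : 1 <= rho by rewrite lerDr sqdist_ge0.
pose B : set ('rV[R]_n * R) :=
  [set v | `|p0.1 - v| <= rho] `*` [set` `[p0.2 - rho, p0.2 + rho]].
have cB : compact B by apply: compact_setX; [exact: ball_compact|exact: segment_compact].
have outB q : ~ B q -> sqdist p0 q0 < sqdist p0 q.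
  move=> Bq; rewrite ltNge; apply/negP => le; apply: Bq.
  have d1 := dotp_ge0 (p0.1 - q.1); have d2 := sqr_ge0 (p0.2 - q.2).
  have rr : sqdist p0 q0 <= rho ^+ 2 by rewrite expr2; rewrite /rho; nra.
  split=> /=.
    apply: le_trans (norm_le_enorm _) _.
    rewrite -(@ler_pXn2r _ 2) // ?nnegrE ?sqrtr_ge0 //; last lra.
    rewrite sqr_enorm; apply: le_trans rr; apply: le_trans le; rewrite /sqdist.
    by move: d1 d2; rewrite !dotpE; lra.
  rewrite in_itv /=; rewrite /sqdist in le rr.
  have : `|p0.2 - q.2| <= rho.
    by rewrite -(@ler_pXn2r _ 2) // ?nnegrE // ?real_normK ?num_real //; lra.
  by rewrite ler_norml; lra.
have inB : B q0 by apply: contrapT => /outB; rewrite ltxx.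
have cK : compact (B `&` closure C) by apply: compact_closedI cB _; exact: closed_closure.
have sc : continuous (sqdist p0) := @sqdist_continuous p0.
have [|p pK pmin] := compact_EVT_min _ cK (continuous_subspaceT sc).
  by exists q0; split=> //; exact: subset_closure.
move: pK; rewrite inE => -[Bp Cp].
have min q : closure C q -> sqdist p0 p <= sqdist p0 q.
  move=> Cq; have [Bq|Bq] := pselect (B q); first by apply: pmin; rewrite inE.
  apply: le_trans (ltW (outB _ Bq)); apply: pmin; rewrite inE; split=> //.
  exact: subset_closure.
exists p; split=> //; last by move=> q Cq; apply: min; exact: subset_closure.
move=> q Cq; rewrite leNgt; apply/negP.
set s := dotp _ _ + _ => s0.
have L0 := sqdist_ge0 q p.
pose t := Num.min 1 (s / (sqdist q p + 1)).
have t0 : 0 < t by rewrite lt_min ltr01 divr_gt0 // ltr_wpDl.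
have t1 : t <= 1 by rewrite ge_min lexx.
have ts : t * (sqdist q p + 1) <= s.
  by rewrite -ler_pdivlMr ?ge_min ?lexx ?orbT // ltr_wpDl.
have t01 : 0 <= t <= 1 by rewrite ltW.
have := min _ (closure_segment cC Cp Cq t01).
have -> : sqdist p0 (p.1 + t *: (q.1 - p.1), p.2 + t * (q.2 - p.2)) =
    sqdist p0 p - t * (2 * s) + t ^+ 2 * sqdist q p.
  rewrite /sqdist /s /= !dotpE !(dotpC p.1) !(dotpC q.1 p0.1); ring.
by rewrite expr2; nra.
Qed.
End Projection.

(** * Affine minorants and existence of subgradients *)

Section AffineMinorants.
Context {R : realType} {n : nat}.
Implicit Types (S : set 'rV[R]_n) (f : 'rV[R]_n -> \bar R).
Implicit Types (u v w x y z : 'rV[R]_n) (a b c t r : R).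

Lemma lsc_near S f x a : lsc S f -> S x -> (a%:E < f x)%E ->
  \forall z \near x, S z -> (a%:E < f z)%E.
Proof.
move=> lf Sx /(lf x a)[V /(@nbhs_subspace_ex 'rV[R]_n S V x Sx)[W xW VW] VH].
apply: filterS xW => z Wz Sz; apply: VH.
by have [] : (V `&` S) z by rewrite VW.
Qed.

Lemma real_below a (e : \bar R) : (a%:E < e)%E -> exists2 b, a < b & (b%:E < e)%E.
Proof.
case: e => [r| |] //; last by exists (a + 1); rewrite ?ltry //; lra.
by rewrite lte_fin => ar; exists ((a + r) / 2); rewrite ?lte_fin; lra.
Qed.

Lemma closure_epigraph S f x b : lsc S f -> S^° x ->
  closure (epigraph S f) (x, b) -> (f x <= b%:E)%E.
Proof.
move=> lf Sx cl; rewrite leNgt; apply/negP => /real_below[a ba af].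
have Sx' := interior_subset Sx.
have near_a : \forall z \near x, (a%:E < f z)%E.
  by apply: filterS2 (lsc_near lf Sx' af) Sx => z; apply.
have near_b : \forall c \near b, c < a by exact: lt_nbhsl.
have [[z c] [[/= _ fz] [/= az ca]]] : (epigraph S f `&`
    ([set z | (a%:E < f z)%E] `*` [set c | c < a])) !=set0.
  by apply: cl; exists ([set z | (a%:E < f z)%E], [set c | c < a]).
by have := lt_le_trans az fz; rewrite lte_fin; lra.
Qed.

(** Here [(y, b)] is the projection of [(x, a)] onto the closed epigraph; the
    hyperplane through it normal to [(x - y, a - b)] is vertical when [a = b].
    The projection is not below [(x, a)] because the epigraph is unbounded
    upwards. *)
Lemma epigraph_projection S f x a : convex_fun S f -> lsc S f ->
  edom S f !=set0 -> S x ->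
  exists y b, [/\ a <= b, closure (epigraph S f) (y, b),
    forall z c, S z -> (f z <= c%:E)%E ->
      dotp (x - y) (z - y) <= (b - a) * (c - b) &
    forall c, (f x <= c%:E)%E -> dotp (x - y) (x - y) <= (c - a) ^+ 2].
Proof.
move=> /convex_funP cf lf [x0 [Sx0 fx0]] Sx.
have [c0 fc0] : exists c0, (f x0 <= c0%:E)%E.
  by case: (f x0) fx0 => [c _|//|_]; [exists c|exists 0; exact: leNye].
move: fx0 => _.
have epi_cvx : forall (p q : 'rV[R]_n * R) t, epigraph S f p -> epigraph S f q ->
    0 <= t <= 1 -> epigraph S f (p.1 + t *: (q.1 - p.1), p.2 + t * (q.2 - p.2)).
  by move=> p q t [Sp fp] [Sq fq] t01; exact: cf.
have epi0 : epigraph S f !=set0 by exists (x0, c0).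
have [[y b] [clp var min]] := convex_projection (x, a) epi_cvx epi0.
exists y, b; split=> //.
- rewrite leNgt; apply/negP => ba.
  set A := dotp (x - y) (x0 - y).
  pose s := `|A| / (a - b) + `|c0 - b| + 1.
  have ab : 0 < a - b by lra.
  have sb : c0 <= b + s.
    have : 0 <= `|A| / (a - b) by rewrite divr_ge0 // ltW.
    by rewrite /s; have := ler_norm (c0 - b); lra.
  have fs : (f x0 <= (b + s)%:E)%E by apply: le_trans fc0 _; rewrite lee_fin.
  have /= := var (x0, b + s) (conj Sx0 fs).
  rewrite (addrC b) addrK -/A leNgt => /negP; apply.
  have -> : (a - b) * s = `|A| + (a - b) * (`|c0 - b| + 1).
    by rewrite /s; field; rewrite gt_eqF.
  have := ler_norm (- A); rewrite normrN; have := normr_ge0 (c0 - b); nra.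
- by move=> z c Sz fz; have /= := var (z, c) (conj Sz fz); lra.
- move=> c fxc; have := min (x, c) (conj Sx fxc).
  rewrite /sqdist /= subrr dotp0l add0r => le1.
  have := sqr_ge0 (a - b); rewrite (_ : (c - a) ^+ 2 = (a - c) ^+ 2); [lra|ring].
Qed.

Definition minorant S f x a v := forall z, S z -> ((a + dotp v (z - x))%R%:E <= f z)%E.

Lemma minorant_of_real S f x a v :
  (forall z c, S z -> (f z <= c%:E)%E -> a + dotp v (z - x) <= c) ->
  minorant S f x a v.
Proof. by move=> H z Sz; apply: le_ereal_of_real => c; exact: H. Qed.

(** A non-vertical separating hyperplane is the graph of an affine minorant. *)
Lemma slope_minorant S f x y a b : a < b ->
  (forall z c, S z -> (f z <= c%:E)%E ->
     dotp (x - y) (z - y) <= (b - a) * (c - b)) ->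
  minorant S f y b ((b - a)^-1 *: (x - y)).
Proof.
move=> ab H; apply: minorant_of_real => z c Sz fz.
have := H z c Sz fz; rewrite dotpZl -ler_pdivrMl ?subr_gt0 //; lra.
Qed.

Lemma minorant_at S f x y a b : a < b ->
  (forall z c, S z -> (f z <= c%:E)%E ->
     dotp (x - y) (z - y) <= (b - a) * (c - b)) ->
  minorant S f x a ((b - a)^-1 *: (x - y)).
Proof.
move=> ab H z Sz; apply: le_trans (slope_minorant ab H Sz).
rewrite lee_fin !dotpZl.
have -> : z - y = (z - x) + (x - y) by rewrite addrA subrK.
rewrite dotpDr mulrDr.
have : 0 <= (b - a)^-1 * dotp (x - y) (x - y).
  by rewrite mulr_ge0 ?dotp_ge0 // invr_ge0; lra.
lra.
Qed.

Lemma affine_minorant_finite S f x a : convex_fun S f -> lsc S f ->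
  S^° x -> f x \is a fin_num -> (a%:E < f x)%E -> exists v, minorant S f x a v.
Proof.
move=> cf lf Sx fx ax; have Sx' := interior_subset Sx.
have dom : edom S f !=set0.
  by exists x; split=> //; case: (f x) fx => // r; rewrite ltry.
have [y [b [ab cl H _]]] := epigraph_projection a cf lf dom Sx'.
move: ab; rewrite le_eqVlt => /predU1P[ab|ab]; last first.
  by exists ((b - a)^-1 *: (x - y)); exact: minorant_at.
have fxle : (f x <= (fine (f x))%:E)%E by rewrite fineK.
have := H x _ Sx' fxle; rewrite ab subrr mul0r => le0.
have xy : x = y.
  by apply/eqP; rewrite -subr_eq0; apply/eqP; exact: dotp_le0.
have := closure_epigraph lf Sx; rewrite {1}xy => /(_ _ cl).
by rewrite -ab leNgt ax.
Qed.

(** Where [f] is infinite the separating hyperplane may be vertical; tilting a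
    known minorant by a large multiple of its normal then raises the value at
    [x] without limit. *)
Lemma affine_minorant S f x a : convex_fun S f -> lsc S f ->
  (forall z, S z -> (-oo < f z)%E) -> edom S f `&` S^° !=set0 ->
  S^° x -> (a%:E < f x)%E -> exists v, minorant S f x a v.
Proof.
move=> cf lf fNy [x0 [[Sx0 fx0] Sx0']] Sx ax.
have Sx' := interior_subset Sx.
have fin0 : f x0 \is a fin_num by rewrite fin_numElt fNy.
have [a0 a0x] : exists a0, (a0%:E < f x0)%E.
  by exists (fine (f x0) - 1); rewrite -{2}(fineK fin0) lte_fin; lra.
have [v0 m0] := affine_minorant_finite cf lf Sx0' fin0 a0x.
have dom : edom S f !=set0 by exists x0.
have [y [b [ab cl H _]]] := epigraph_projection a cf lf dom Sx'.
move: ab; rewrite le_eqVlt => /predU1P[ab|ab]; last first.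
  by exists ((b - a)^-1 *: (x - y)); exact: minorant_at.
have xy : x != y.
  apply: contraTneq ax => xy; rewrite -leNgt.
  by apply: closure_epigraph lf Sx _; rewrite xy ab.
pose N := dotp (x - y) (x - y); have N0 : 0 < N.
  rewrite lt_neqAle dotp_ge0 andbT eq_sym; apply: contra xy => /eqP/dotp_eq0/eqP.
  by rewrite subr_eq0.
pose c0 := a0 + dotp v0 (x - x0); pose s := `|a - c0| / N.
exists (v0 + s *: (x - y)); apply: minorant_of_real => z c Sz fz.
have le1 := H z c Sz fz; rewrite ab subrr mul0r in le1.
have : ((a0 + dotp v0 (z - x0))%:E <= c%:E)%E by apply: le_trans (m0 z Sz) fz.
rewrite lee_fin => le2.
have s0 : 0 <= s by rewrite divr_ge0 // ltW.
have sN : a - c0 <= s * N by rewrite divfK ?gt_eqF // ler_norm.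
have zE : dotp (x - y) (z - x) = dotp (x - y) (z - y) - N.
  by rewrite /N !dotpE; lra.
have : s * dotp (x - y) (z - y) <= 0 by rewrite mulr_ge0_le0.
rewrite [dotp (v0 + _) _]dotpDl dotpZl zE; move: sN le2; rewrite /c0 !dotpE; lra.
Qed.

(** Projecting from just below the graph at [x] lands on the graph so close to
    [x] that the base point is still interior, and there the separating
    hyperplane is not vertical. *)
Lemma interior_subgradient_point S f x : convex_fun S f -> lsc S f ->
  S^° x -> f x \is a fin_num -> exists y v, S^° y /\ subgradient S f y v.
Proof.
move=> cf lf Sx fx; have Sx' := interior_subset Sx.
have [r r0 rS] : exists2 r, 0 < r & forall z, `|z - x| <= r -> S^° z.
  by apply/nbhs_dist_leP; exact: nbhs_interior.
pose a := fine (f x) - r.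
have ax : (a%:E < f x)%E by rewrite -(fineK fx) lte_fin /a; lra.
have dom : edom S f !=set0.
  by exists x; split=> //; case: (f x) fx => // s; rewrite ltry.
have [y [b [ab cl H near_x]]] := epigraph_projection a cf lf dom Sx'.
have fxle : (f x <= (fine (f x))%:E)%E by rewrite fineK.
have Sy : S^° y.
  apply: rS; rewrite distrC; apply: le_trans (norm_le_enorm _) _.
  rewrite -(@ler_pXn2r _ 2) // ?nnegrE ?sqrtr_ge0 //; last exact: ltW.
  by rewrite sqr_enorm; apply: le_trans (near_x _ fxle) _; rewrite /a subKr.
have fyb : (f y <= b%:E)%E by exact: closure_epigraph lf Sy cl.
have {}ab : a < b.
  move: ab; rewrite le_eqVlt => /predU1P[ab|//].
  have := H x _ Sx' fxle; rewrite ab subrr mul0r => le0.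
  have xy : x = y.
    by apply/eqP; rewrite -subr_eq0; apply/eqP; exact: dotp_le0.
  by move: ax; rewrite xy ab ltNge fyb.
have m := slope_minorant ab H.
have Sy' := interior_subset Sy.
have fyE : f y = b%:E.
  apply/le_anti; rewrite fyb /=.
  by have := m y Sy'; rewrite subrr dotp0r addr0.
by exists y, ((b - a)^-1 *: (x - y)); split=> //; split; rewrite // fyE.
Qed.

Lemma dotp_bound_enorm v r c : 0 < r ->
  (forall w, `|w| <= r -> dotp v w <= c) -> r * enorm v <= c.
Proof.
move=> r0 H; have [->|v0] := eqVneq v 0.
  by rewrite /enorm dotp0l sqrtr0 mulr0; have := H 0; rewrite normr0 ltW // dotp0r; exact.
have e0 := enorm_gt0 v0.
have := H ((r / enorm v) *: v); rewrite dotpZr -sqr_enorm.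
have -> : r / enorm v * enorm v ^+ 2 = r * enorm v by field; rewrite gt_eqF.
apply; rewrite normrZ gtr0_norm ?divr_gt0 // mulrAC ler_pdivrMr // ler_pM2l //.
exact: norm_le_enorm.
Qed.

(** Near-subgradients at [x] are bounded as soon as [f] is bounded above around
    [x]; a cluster point of them is a subgradient. *)
Lemma subgradient_exists S f x (M : R) : convex_fun S f -> lsc S f ->
  S^° x -> f x \is a fin_num -> (\forall z \near x, (f z <= M%:E)%E) ->
  exists v, subgradient S f x v.
Proof.
move=> cf lf Sx fx nearM; have Sx' := interior_subset Sx.
have /choice[xi xiH] (k : nat) : exists v, minorant S f x (fine (f x) - k.+1%:R^-1) v.
  apply: affine_minorant_finite => //.
  by rewrite -{2}(fineK fx) lte_fin ltrBlDr ltrDl invr_gt0.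
have [r r0 rS] : exists2 r, 0 < r & forall z, `|z - x| <= r -> S z /\ (f z <= M%:E)%E.
  by apply/nbhs_dist_leP; apply: filterS2 Sx nearM.
pose C := (M - fine (f x) + 1) / r.
have xiC k : `|0 - xi k| <= C.
  rewrite sub0r normrN; apply: le_trans (norm_le_enorm _) _; rewrite ler_pdivlMr // mulrC.
  apply: dotp_bound_enorm => // w wr.
  have := rS (w + x); rewrite addrK => /(_ wr)[Sw fw].
  have := le_trans (xiH k _ Sw) fw; rewrite lee_fin addrK.
  have : k.+1%:R^-1 <= 1 :> R by rewrite invf_le1 // ler1n.
  by set e := _^-1; lra.
have [v [_ vcl]] : ([set v : 'rV[R]_n | `|0 - v| <= C] `&`
    cluster (xi @ \oo)) !=set0.
  apply: (@ball_compact R n 0 C (xi @ \oo)).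
  by exists 0%N => // k _; exact: xiC.
exists v; split=> //; apply: minorant_of_real => z a Sz fz.
rewrite leNgt; apply/negP => lt_a.
pose d := fine (f x) + dotp v (z - x) - a; have d0 : 0 < d by rewrite subr_gt0.
have A1 : (xi @ \oo) [set w | fine (f x) - d / 2 + dotp w (z - x) <= a].
  have h2 : 0 < d / 2 by rewrite divr_gt0.
  rewrite /= nbhs_simpl; have := near_infty_natSinv_lt (PosNum h2).
  apply: filterS => k /= kd.
  have := le_trans (xiH k _ Sz) fz; rewrite lee_fin.
  by move: kd; rewrite /=; set e := _^-1; lra.
have A2 : nbhs v [set w | dotp v (z - x) - d / 2 < dotp w (z - x)].
  have cv : dotp (z - x) w @[w --> v] --> dotp (z - x) v by exact: dotp_continuous.
  have lt : dotp v (z - x) - d / 2 < dotp (z - x) v by rewrite dotpC; lra.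
  by apply: filterS (cvgr_gt _ cv _ lt) => w /=; rewrite (dotpC w).
have [w [/= H1 H2]] := vcl _ _ A1 A2.
by rewrite /d in H1 H2; lra.
Qed.

End AffineMinorants.

(** * Gradient of the conjugate *)

Section ConjugateGradient.
Context {R : realType} {n : nat}.
Implicit Types (S : set 'rV[R]_n) (f phi : 'rV[R]_n -> \bar R).
Implicit Types (u v w x y z : 'rV[R]_n) (a b c t r : R).

Lemma sphere_compact x r : compact [set z : 'rV[R]_n | `|x - z| = r].
Proof.
have -> : [set z : 'rV[R]_n | `|x - z| = r] =
    [set z | `|x - z| <= r] `&` ~` ball x r.
  rewrite -ball_normE; apply/seteqP; split=> z /=.
    by move=> zr; rewrite zr ltxx lexx.
  by move=> [le /negP]; rewrite -leNgt => ge; apply/le_anti; rewrite le.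
apply: compact_closedI; first exact: ball_compact.
by apply: open_closedC; exact: ball_open.
Qed.

Lemma segment_closed_convex_set (A : set 'rV[R]_n) : segment_closed A ->
  convex_set (A : set (convex_lmodType 'rV[R]_n)).
Proof.
move=> cA y y' t; rewrite !inE => Ay Ay'.
have t01 : 0 <= t%:num <= 1 by rewrite ge0 le1.
have := cA y' y _ Ay' Ay t01.
rewrite (_ : (_ + _ : 'rV[R]_n) =
  t%:num *: (y : 'rV[R]_n) + (1 - t%:num) *: (y' : 'rV[R]_n)) //.
by apply/rowP => i; rewrite !mxE; ring.
Qed.

Lemma strict_above_tangent phi x z : convex_fun setT phi ->
  essentially_strictly_convex phi ->
  (forall y, (edom setT phi)^° y -> differentiable_at setT phi y) ->
  (edom setT phi)^° x -> (edom setT phi)^° z -> x <> z ->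
  fine (phi x) + dotp (grad phi x) (z - x) < fine (phi z).
Proof.
move=> cphi sphi dphi Xx Xz xz.
have sub y : (edom setT phi)^° y -> subgradient setT phi y (grad phi y).
  by move=> Xy; apply: grad_subgradient => //; exact: dphi.
have Xcvx : segment_closed (edom setT phi)^°.
  exact: interior_convex (edom_convex cphi).
have Xcvx' : convex_set ((edom setT phi)^° : set (convex_lmodType 'rV[R]_n)).
  exact: segment_closed_convex_set.
have Xdom : (edom setT phi)^° `<=` dom_subdiff setT phi.
  by move=> y Xy; exists (grad phi y); apply: subgradient_limiting_subdiff; exact: sub.
have half : 0 < (2^-1 : R) < 1 by rewrite invr_gt0 ltr0n invf_lt1 ?ltr1n.
have := sphi _ Xcvx' Xdom x z 2^-1 Xx Xz xz half.
have [_ finx Hx] := sub x Xx; have [_ finz _] := sub z Xz.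
have := Hx (2^-1 *: x + (1 - 2^-1) *: z) I.
rewrite -[X in (_ + _ * X)%E](fineK finz) -[X in (_ * X + _)%E](fineK finx).
rewrite -!EFinM -EFinD => le1 lt1; have := le_lt_trans le1 lt1; rewrite lte_fin.
by rewrite !dotpE; lra.
Qed.

(** Strict convexity makes [phi] exceed its tangent at [x] by a positive amount
    on a small sphere around [x], hence linearly outside it.  At slopes close to
    [grad phi x], the supremum defining the conjugate is therefore governed by
    the points inside that sphere, whose distance to [x] bounds the remainder of
    the expansion with gradient [x]. *)
Lemma grad_fenchel phi x : convex_fun setT phi ->
  (forall z, (-oo < phi z)%E) ->
  essentially_strictly_convex phi ->
  (forall y, (edom setT phi)^° y -> differentiable_at setT phi y) ->
  (edom setT phi)^° x ->
  differentiable_at setT (fenchel phi) (grad phi x) /\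
  grad (fenchel phi) (grad phi x) = x.
Proof.
move=> cphi phiNy sphi dphi Xx; set eta := grad phi x.
have sub : subgradient setT phi x eta by apply: grad_subgradient => //; exact: dphi.
have [_ finx Hx] := sub.
have fsub : subgradient setT (fenchel phi) eta x.
  by have := subgradient_fenchel sub; rewrite canonical_extT.
have fE : fenchel phi eta = (dotp x eta - fine (phi x))%:E.
  by have := fenchel_subgradient sub; rewrite canonical_extT.
apply: subgradient_squeeze fsub _ => e e0.
have [r0 r00 r0X] : exists2 r, 0 < r & forall z, `|z - x| <= r -> (edom setT phi)^° z.
  by apply/nbhs_dist_leP; exact: nbhs_interior.
have n0 : 0 < n%:R + 1 :> R by rewrite ltr_wpDl.
pose r := Num.min r0 (e / (n%:R + 1)).
have r_gt0 : 0 < r by rewrite lt_min r00 divr_gt0.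
have rX z : `|z - x| <= r -> (edom setT phi)^° z.
  by move=> zr; apply: r0X; apply: le_trans zr _; rewrite ge_min lexx.
have nre : (n%:R + 1) * r <= e by rewrite mulrC -ler_pdivlMr // ge_min lexx orbT.
pose g z := fine (phi z) - fine (phi x) - (dotp eta z - dotp eta x).
have gE z : g z = fine (phi z) - fine (phi x) - dotp eta (z - x).
  by rewrite /g dotpDr dotpNr.
have [m m0 mH] : exists2 m, 0 < m & forall z, `|x - z| = r -> m <= g z.
  (* The sphere is empty in dimension zero. *)
  have [[z0 z0r]|no] := pselect (exists z, `|x - z| = r); last first.
    by exists 1 => // z zr; case: no; exists z.
  have gc : {within [set z | `|x - z| = r], continuous g}.
    apply: continuous_in_subspaceT => z; rewrite inE /= distrC => zr.
    have zr' : `|z - x| <= r by rewrite zr.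
    have [_ /differentiable_continuous dz] := dphi z (rX z zr').
    have c1 : (fine (phi w) - fine (phi x)) @[w --> z] --> fine (phi z) - fine (phi x).
      have c0 : fine (phi w) @[w --> z] --> fine (phi z) by exact: dz.
      exact: (cvgB c0 (cvg_cst _)).
    have c2 := cvgB (@dotp_continuous R n eta z) (cvg_cst (dotp eta x)).
    exact: (cvgB c1 (c2 (nbhs_filter z) (nbhs_filter z))).
  have sphere0 : [set z | `|x - z| = r] !=set0 by exists z0.
  have [z] := compact_EVT_min sphere0 (@sphere_compact x r) gc.
  rewrite inE => zr zmin; exists (g z); last by move=> y yr; apply: zmin; rewrite inE.
  have zx : x <> z.
    by move=> xz; move: zr r_gt0; rewrite /= xz subrr normr0 => ->; rewrite ltxx.
  have := strict_above_tangent cphi sphi dphi Xx (rX z _) zx.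
  by rewrite distrC zr lexx gE => /(_ isT); rewrite -/eta; lra.
have far z a : r <= `|z - x| -> (phi z <= a%:E)%E ->
    m / r * `|z - x| <= a - fine (phi x) - dotp eta (z - x).
  move=> rz fza; have N0 : 0 < `|z - x| by lra.
  pose t := r / `|z - x|; have t0 : 0 < t by rewrite divr_gt0.
  have t01 : 0 <= t <= 1 by rewrite ltW // ler_pdivrMr // mul1r.
  have fxle : (phi x <= (fine (phi x))%:E)%E by rewrite fineK.
  have [_ le1] := (convex_funP _ _).1 cphi x z _ a t I I fxle fza t01.
  have yr : `|x - (x + t *: (z - x))| = r.
    by rewrite opprD addNKr normrN normrZ gtr0_norm // divfK // gt_eqF.
  have Xy : (edom setT phi)^° (x + t *: (z - x)) by apply: rX; rewrite distrC yr.
  have [_ finy] := differentiable_at_fin (dphi _ Xy).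
  have := mH _ yr; move: le1; rewrite -(fineK finy) lee_fin gE (addrC x) addrK dotpZr.
  move=> le1 le2.
  have le3 : m <= t * (a - fine (phi x) - dotp eta (z - x)) by lra.
  rewrite -(@ler_pM2l _ t) //; apply: le_trans le3.
  have -> : t * (m / r * `|z - x|) = m by rewrite /t; field; rewrite !gt_eqF.
  exact: lexx.
have d0 : 0 < m / (r * (n%:R + 1)) by rewrite divr_gt0 // mulr_gt0.
apply: filterS (near_dist_le eta d0) => zeta zd; split=> //.
apply: fenchel_le => z; have := phiNy z.
case E : (phi z) => [a| |] // _; last by rewrite /= leNye.
  rewrite fE -EFinB lee_fin /=.
  have db := dotp_le_norm (z - x) (zeta - eta).
  have db' := ler_norm (dotp (z - x) (zeta - eta)).
  have [far_z|near_z] := lerP r `|z - x|.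
    have := far z a far_z; rewrite E lexx => /(_ isT).
    have : n%:R * (`|z - x| * `|zeta - eta|) <= m / r * `|z - x|.
      rewrite mulrCA mulrC ler_pM2r; last lra.
      have : (n%:R + 1) * `|zeta - eta| <= m / r.
        apply: le_trans (ler_wpM2l (ltW n0) zd) _.
        by rewrite le_eqVlt; apply/orP; left; apply/eqP; field; rewrite !gt_eqF.
      have := normr_ge0 (zeta - eta); lra.
    have := mulr_ge0 (ltW e0) (normr_ge0 (zeta - eta)).
    move: db db'; rewrite !dotpE !(dotpC x) !(dotpC z); lra.
  have := Hx z I; rewrite E lee_fin.
  have : n%:R * (`|z - x| * `|zeta - eta|) <= e * `|zeta - eta|.
    rewrite mulrA ler_wpM2r //.
    have : n%:R * `|z - x| <= n%:R * r by rewrite ler_wpM2l // ltW.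
    lra.
  move: db db'; rewrite !dotpE !(dotpC x) !(dotpC z); lra.
Qed.

End ConjugateGradient.

(** * The descent inequality and its conjugate *)

(** Inner products and finite values become the variables of a linear problem,
    in which [dotpC] identifies the two orders of the factors.  Gradients are
    generalised first, as matching inner products up to conversion would unfold
    them. *)
Ltac dotp_lra :=
  repeat match goal with
  | |- context [grad ?g ?x] => generalize (grad g x); intro
  end;
  rewrite ?dotpE /=;
  repeat match goal with
  | |- context [dotp ?u ?v] =>
      generalize (dotpC u v); generalize (dotp u v); generalize (dotp v u); intros ? ? ?
  | |- context [fine ?e] => let s := fresh in set s := (fine e); clearbody s
  end; lra.

Section Descent.
Context {R : realType} {n : nat}.
Implicit Types (S : set 'rV[R]_n) (f phi : 'rV[R]_n -> \bar R).
Implicit Types (u v w x y z : 'rV[R]_n) (a b c t r : R).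

(** Test the subgradient inequality at [x + s (v - grad f x)] for small [s > 0]. *)
Lemma subgradient_grad S f x v : subgradient S f x v -> differentiable_at S f x ->
  v = grad f x.
Proof.
move=> [Sx finx H] df; have Fx := differentiable_first_order df.
apply/eqP; rewrite -subr_eq0; apply/eqP/dotp_eq0.
set w := v - grad f x; have [->|w0] := eqVneq w 0; first by rewrite dotp0l.
have N0 : 0 < `|w| by rewrite normr_gt0.
apply/le_anti; rewrite dotp_ge0 andbT; apply/ler_addgt0Pr => e e0; rewrite add0r.
have [nearS _] := df.
have [r r0 rH] : exists2 r, 0 < r & forall z, `|z - x| <= r ->
    (S z /\ f z \is a fin_num) /\
    `|fine (f z) - fine (f x) - dotp (grad f x) (z - x)| <= e / `|w| * `|z - x|.
  by apply/nbhs_dist_leP; apply: filterS2 nearS (Fx _ (divr_gt0 e0 N0)).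
pose s := r / `|w|; have s0 : 0 < s by rewrite divr_gt0.
have := rH (s *: w + x); rewrite addrK normrZ gtr0_norm // divfK ?gt_eqF // lexx.
move=> /(_ isT)[[Sz finz] /ler_normlP[_]].
have := H _ Sz; rewrite addrK -(fineK finz) lee_fin => le1 le2.
have : s * dotp w w <= e / `|w| * r.
  by move: le1 le2; rewrite {3}/w !dotpZr dotpDl dotpNl; lra.
have -> : e / `|w| * r = s * e by rewrite /s; ring.
by rewrite ler_pM2l.
Qed.

(** The support at a point of a segment bounds both ends from below; the average
    of the two bounds is the convexity inequality. *)
Lemma convex_of_support S f : segment_closed S ->
  (forall x, S x -> exists v, subgradient S f x v) -> convex_fun S f.
Proof.
move=> cS sup; apply/convex_funP => x y a b t Sx Sy fa fb t01.
have Sm := cS x y t Sx Sy t01; split=> //.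
have [v [_ finm H]] := sup _ Sm.
have := le_trans (H x Sx) fa; have := le_trans (H y Sy) fb.
rewrite -[in X in _ -> _ -> X](fineK finm) !lee_fin !dotpE.
by move: t01 => /andP[t0 t1]; nra.
Qed.

End Descent.

Section Implications.
Context {R : realType} {n : nat}.
Implicit Types (u v w x y z xi eta : 'rV[R]_n) (a b c t r : R).
Context (phi f : 'rV[R]_n -> \bar R).
Local Notation X := (edom setT phi).
Local Notation phis := (fenchel phi).
Local Notation fs := (fenchel (canonical_ext X f)).
Context (cphi : convex_fun setT phi) (phiNy : forall z, (-oo < phi z)%E).
Context (dphi : forall y, X^° y -> differentiable_at setT phi y).
Context (fNy : forall z, X z -> (-oo < f z)%E) (lf : lsc X f) (cf : convex_fun X f).
Context (f_int : edom X f `&` X^° !=set0).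

Let cX : segment_closed X. Proof. exact: edom_convex. Qed.

Lemma phi_fin z : X z -> phi z \is a fin_num.
Proof. by move=> [_ ?]; rewrite fin_numElt phiNy. Qed.

Lemma phi_finE z : X z -> exists a, phi z = a%:E.
Proof. by move=> /phi_fin; case: (phi z) => // a; exists a. Qed.

Lemma phi_subgradient x : X^° x -> subgradient setT phi x (grad phi x).
Proof. by move=> Xx; apply: grad_subgradient => //; exact: dphi. Qed.

Lemma phis_grad x : X^° x ->
  phis (grad phi x) = (dotp x (grad phi x) - fine (phi x))%R%:E.
Proof.
by move=> /phi_subgradient /fenchel_subgradient; rewrite canonical_extT.
Qed.

Definition tangent_gap x xi z :=
  fine (f x) - fine (phi x) - dotp (grad phi x - xi) (z - x).

(** The descent inequality: [f] lies below the copy of [phi] that is tilted and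
    lifted so as to touch [f] at [x] with slope [xi]. *)
Definition descent x xi A := forall z, A z -> (f z <= phi z + (tangent_gap x xi z)%:E)%E.

(** The descent inequality after taking conjugates of both sides.  The constant
    is [fenchel phi (grad phi x)] minus the conjugate of [f] at [xi] when [xi] is
    a subgradient of [f] at [x]. *)
Definition conj_descent x xi := forall eta,
  (phis (eta - xi + grad phi x)%R <=
   fs eta + (dotp x (grad phi x - xi) - fine (phi x) + fine (f x))%R%:E)%E.

Lemma descent_conj x xi : descent x xi X -> conj_descent x xi.
Proof.
move=> H eta; apply: fenchel_le => z.
have := phiNy z; case E : (phi z) => [a| |] // _; last by rewrite /= leNye.
have Xz : X z by split; rewrite // E ltry.
have := H z Xz; have := fenchel_ext_ge f eta Xz; have := fNy Xz.
case: (f z) => [b| |] // _; last by rewrite E.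
rewrite E -!EFinB -EFinD lee_fin => le1 le2.
apply: (@le_trans _ _ ((dotp z eta - b) +
    (dotp x (grad phi x - xi) - fine (phi x) + fine (f x)))%R%:E).
  by move: le2; rewrite lee_fin /tangent_gap; dotp_lra.
by rewrite EFinD leeD2r.
Qed.

(** Back from the conjugate form: the affine minorants of [f] recover [f] at
    interior points, and each of them is controlled by the inequality between
    conjugates evaluated at its slope. *)
Lemma conj_descent_descent x xi : conj_descent x xi -> descent x xi X^°.
Proof.
move=> H z Xz; have Xz' := interior_subset Xz.
have [p pE] := phi_finE Xz'; rewrite pE -EFinD leNgt; apply/negP => /real_below[a Ua af].
have [v m] := affine_minorant cf lf fNy f_int Xz af.
have : (fs v <= (dotp z v - a)%:E)%E.
  apply: fenchel_ext_le => y Xy; apply: le_trans (m y Xy).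
  by rewrite lee_fin; dotp_lra.
move: af => _; have := H v; have := fenchel_ge phi z (v - xi + grad phi x); rewrite pE.
move=> le1 le2 le3; have := le_trans le1 (le_trans le2 (leeD2r _ le3)).
rewrite -EFinB -EFinD lee_fin => le4.
by move: Ua le4; rewrite /tangent_gap; dotp_lra.
Qed.

(** The inequality extends from the interior of [X] to [X] along segments, where
    [phi] is convex and [f] is lower semicontinuous. *)
Lemma descent_closure x xi : X^° x -> f x \is a fin_num ->
  descent x xi X^° -> descent x xi X.
Proof.
move=> Xx finfx H z Xz; have [p pE] := phi_finE Xz.
rewrite pE -EFinD leNgt; apply/negP; set U := p + _ => /real_below[a Ua af].
have [r r0 rH] : exists2 r, 0 < r & forall y, `|y - z| <= r -> X y -> (a%:E < f y)%E.
  by apply/nbhs_dist_leP; exact: lsc_near lf Xz af.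
pose N := `|x - z| + 1; pose D := `|fine (f x) - U| + 1.
have N0 : 0 < N by rewrite ltr_wpDl.
have D0 : 0 < D by rewrite ltr_wpDl.
(* At parameter [1 - s] the segment is close enough to [z] for [f] to exceed
   [a] there, and its upper bound has come within [a - U] of [U]. *)
pose s := Num.min 1 (Num.min (r / N) ((a - U) / D)).
have s0 : 0 < s by rewrite !lt_min ltr01 !divr_gt0 // subr_gt0.
have s1 : s <= 1 by rewrite ge_min lexx.
have sr : s * N <= r by rewrite -ler_pdivlMr // /s !ge_min lexx !orbT.
have sa : s * D <= a - U by rewrite -ler_pdivlMr // /s !ge_min lexx !orbT.
have Xy : X^° (x + (1 - s) *: (z - x)).
  by apply: interior_segment => //; rewrite subr_ge0 s1 gtrBl.
have yz : x + (1 - s) *: (z - x) - z = s *: (x - z).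
  by apply/rowP => i; rewrite !mxE; ring.
have := rH (x + (1 - s) *: (z - x)).
rewrite yz normrZ gtr0_norm // => /(_ _ (interior_subset Xy)).
have sNr : s * `|x - z| <= r by apply: le_trans sr; rewrite ler_pM2l // lerDl.
move=> /(_ sNr); apply/negP; rewrite -leNgt; apply: le_trans (H _ Xy) _.
have [q qE] := phi_finE (interior_subset Xx).
have [] := (convex_funP _ _).1 cphi x z q p (1 - s) I I _ _ _.
- by rewrite qE.
- by rewrite pE.
- by rewrite subr_ge0 s1 gerBl ltW.
move=> _ le1; apply: le_trans (leeD2r _ le1) _; rewrite -EFinD lee_fin.
have : s * (fine (f x) - U) <= s * D.
  by rewrite ler_pM2l // (le_trans (ler_norm _)) // lerDl.
move: sa; rewrite {1 2}/U /tangent_gap qE /= (addrC x) addrK !dotpZr; nra.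
Qed.

(** The descent inequality at [x] supports [phi - f] at [x] with slope
    [grad phi x - xi]. *)
Lemma descent_convex : (forall x, X^° x -> f x \is a fin_num) ->
  (forall x, X^° x -> exists xi, descent x xi X^°) ->
  convex_fun X^° (fun z => phi z - f z)%E.
Proof.
move=> finf H; apply: convex_of_support; first exact: interior_convex.
move=> x Xx; have [xi D] := H x Xx; exists (grad phi x - xi).
have [p pE] := phi_finE (interior_subset Xx).
have := finf x Xx; case fE : (f x) => [b| |] // _.
split=> //; first by rewrite pE fE.
move=> z Xz; have := D z Xz; rewrite /tangent_gap.
have [q ->] := phi_finE (interior_subset Xz).
have := finf z Xz; case: (f z) => [c| |] // _.
by rewrite pE fE -EFinD -EFinB !lee_fin /=; lra.
Qed.

Lemma B_smooth_fin x : diff_on_int X f -> X^° x -> f x \is a fin_num.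
Proof. by move=> df /df /differentiable_at_fin[]. Qed.

Lemma B_smooth_descent x : B_smooth phi f -> X^° x -> descent x (grad f x) X.
Proof.
move=> [df cq] Xx; apply: descent_closure => //; first exact: B_smooth_fin.
have finf := B_smooth_fin df.
have finp z (Xz : X^° z) := phi_fin (interior_subset Xz).
have Xx' := nbhs_interior Xx.
have dq : first_order (fine \o (fun z => phi z - f z)%E) x (grad phi x - grad f x).
  move=> e e0; have e20 : 0 < e / 2 by rewrite divr_gt0.
  have split_error (a b a' b' p q M : R) :
      `|a - a' - p| <= e / 2 * M -> `|b - b' - q| <= e / 2 * M ->
      `|a - b - (a' - b') - (p - q)| <= e * M by rewrite !ler_norml; lra.
  have d1 := differentiable_first_order (dphi Xx) e20.
  have d2 := differentiable_first_order (df x Xx) e20.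
  apply: filterS3 Xx' d1 d2 => z Xz /= le1 le2.
  rewrite !fineB ?finp ?finf // dotpDl dotpNl.
  exact: split_error le1 le2.
have fin_q z : X^° z -> (phi z - f z)%E \is a fin_num.
  by move=> Xz; rewrite fin_numB finp // finf.
have [_ _ sub] := first_order_subgradient cq Xx (fin_q x Xx) dq (filterS fin_q Xx').
move=> z Xz; have := sub z Xz.
rewrite fineB ?finp ?finf // -(fineK (finp z Xz)) -(fineK (finf z Xz)).
by rewrite -EFinB -EFinD !lee_fin /tangent_gap; lra.
Qed.

Lemma B_smooth_conj_descent x : B_smooth phi f -> X^° x -> conj_descent x (grad f x).
Proof. by move=> sf Xx; apply: descent_conj; exact: B_smooth_descent. Qed.

Lemma diff_subgradient x : diff_on_int X f -> X^° x -> subgradient X f x (grad f x).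
Proof. by move=> df Xx; apply: grad_subgradient => //; exact: df. Qed.


Lemma conj_descent_gap x : X^° x -> diff_on_int X f -> conj_descent x (grad f x) ->
  forall xi y, subgradient X f y xi ->
  (phis (xi - grad f x + grad phi x)%R <=
     (dotp y xi - fine (f y) + dotp x (grad phi x - grad f x)
      - fine (phi x) + fine (f x))%R%:E)%E.
Proof.
move=> Xx df H xi y sub; apply: le_trans (H xi) _.
by rewrite (fenchel_subgradient sub) -EFinD lee_fin; dotp_lra.
Qed.

Lemma B_smooth_cocoercive :
  (forall x, X^° x -> grad phis (grad phi x) = x) ->
  B_smooth phi f -> extended_B_cocoercive phi f.
Proof.
move=> gphis sf; have [df _] := sf; split=> // xb x xi Xxb.
move=> /(limiting_subdiffP _ _ cf fNy) sub.
have := conj_descent_gap Xxb df (B_smooth_conj_descent sf Xxb) sub.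
rewrite /bregman phis_grad // gphis //.
have -> : (grad phi xb - (grad f xb - xi) = xi - grad f xb + grad phi xb)%R.
  by rewrite opprB addrC.
have [_ finx _] := sub.
rewrite -(fineK (B_smooth_fin df Xxb)) -(fineK finx).
case: (phis _) => [c| |] //; rewrite -!EFinB ?lee_fin ?leNye //.
dotp_lra.
Qed.

Lemma extended_cocoercive_cocoercive : extended_B_cocoercive phi f -> B_cocoercive phi f.
Proof.
move=> [df H]; split=> // x xb Xx Xxb; apply: H => //.
by apply: subgradient_limiting_subdiff; exact: diff_subgradient.
Qed.

(** Bounding [fenchel phi] from below by the Fenchel-Young inequality at the
    other point turns cocoercivity into the descent inequality. *)
Lemma cocoercive_B_smooth :
  (forall x, X^° x -> grad phis (grad phi x) = x) ->
  B_cocoercive phi f -> B_smooth phi f.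
Proof.
move=> gphis [df H]; split=> //; apply: descent_convex.
  by move=> x; exact: B_smooth_fin.
move=> xb Xxb; exists (grad f xb) => x Xx.
have := H x xb Xx Xxb; have := fenchel_ge phi x (grad phi xb - (grad f xb - grad f x)).
rewrite /bregman phis_grad // gphis // /tangent_gap.
rewrite -(fineK (B_smooth_fin df Xxb)) -(fineK (B_smooth_fin df Xx)).
rewrite -(fineK (phi_fin (interior_subset Xx))).
case: (phis _) => [c| |] //; rewrite -!EFinB -?EFinD !lee_fin.
dotp_lra.
Qed.

Lemma fs_gtNy eta : (-oo < fs eta)%E.
Proof.
apply: fenchel_ext_gtNy => //.
by have [x [? _]] := f_int; exists x.
Qed.

Lemma limiting_subdiff_fs xi x :
  limiting_subdiff setT fs xi x <-> subgradient setT fs xi x.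
Proof.
by apply: limiting_subdiffP; [exact: fenchel_convex|move=> eta _; exact: fs_gtNy].
Qed.

(** The subgradient inequality of the conjugate, evaluated at [grad f x], bounds
    the conjugate at [xi] by its Fenchel-Young value; so [xi] is a subgradient of
    [f] at [x]. *)
Lemma subgradient_fs_grad xi x : differentiable_at X f x ->
  subgradient setT fs xi x -> xi = grad f x.
Proof.
move=> df [_ fin_xi H]; have [Xx finx] := differentiable_at_fin df.
have sub := grad_subgradient cf df.
apply: subgradient_grad df; split=> // z Xz.
have := H (grad f x) I; rewrite (fenchel_subgradient sub).
have := fenchel_ext_ge f xi Xz; have := fNy Xz.
case: (fs xi) fin_xi => [k _| |] //.
case: (f z) => [c _| |//]; last by rewrite leey.
rewrite -EFinB !lee_fin /=; dotp_lra.
Qed.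

Lemma B_smooth_aniso : B_smooth phi f -> conj_aniso_strongly_convex phi f.
Proof.
move=> sf X' fs' xi xib xb /limiting_subdiff_fs sub Xxb; rewrite {}/fs' {}/X' in Xxb *.
have [df _] := sf.
have gE := subgradient_fs_grad (df xb Xxb) sub.
have := B_smooth_conj_descent sf Xxb xi.
rewrite -gE phis_grad // gE (fenchel_subgradient (diff_subgradient df Xxb)).
have := fs_gtNy xi; case: (fs xi) => [b| |] // _; last by move=> _; exact: leey.
case: (phis _) => [c| |] //; rewrite -?EFinD -?EFinB ?lee_fin ?leNye //.
by dotp_lra.
Qed.

(** The function [h] whose conjugate represents [phi - f]. *)
Definition envelope eta : \bar R :=
  ereal_sup [set (phis (xi - eta)%R - fs xi)%E | xi in [set: 'rV[R]_n]].

Lemma B_smooth_dom : B_smooth phi f -> edom X f = X.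
Proof.
move=> sf; apply/seteqP; split=> [z []//|z Xz]; split=> //.
have [x0 [_ Xx0]] := f_int.
apply: le_lt_trans (B_smooth_descent sf Xx0 Xz) _.
by have [p ->] := phi_finE Xz; rewrite -EFinD ltry.
Qed.

(** The slope [grad f x], taken in the supremum defining the envelope, bounds it
    from below at every point by an affine function; the conjugate descent
    inequality is the matching upper bound at [grad f x - grad phi x]. *)
Lemma B_smooth_envelope x : B_smooth phi f -> X^° x ->
  fenchel envelope (- x) = (fine (phi x) - fine (f x))%:E.
Proof.
move=> sf Xx; have [df _] := sf; have Xx' := interior_subset Xx.
have sub := diff_subgradient df Xx.
apply/le_anti/andP; split.
  apply: fenchel_le => eta.
  have : (phis (grad f x - eta)%R - fs (grad f x) <= envelope eta)%E.
    by apply: ereal_sup_ubound; exists (grad f x).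
  rewrite (fenchel_subgradient sub).
  have := fenchel_ge phi x (grad f x - eta).
  rewrite -{1}(fineK (phi_fin Xx')).
  case: (phis _) => [c| |] //; case: (envelope eta) => [h| |] //;
    rewrite -?EFinB ?lee_fin ?leNye //.
  by dotp_lra.
set eta := grad f x - grad phi x.
apply: le_trans (fenchel_ge envelope eta (- x)).
have : (envelope eta <= (- dotp eta x - fine (phi x) + fine (f x))%:E)%E.
  apply: ge_ereal_sup => _ [xi _ <-].
  have := B_smooth_conj_descent sf Xx xi.
  have -> : (xi - grad f x + grad phi x = xi - eta)%R.
    by rewrite opprB addrA addrAC.
  have := fs_gtNy xi; case: (fs xi) => [b| |] // _; last first.
    by move=> _; case: (phis _) => [c| |] //=; rewrite leNye.
  case: (phis _) => [c| |] //; rewrite -?EFinD -?EFinB ?lee_fin ?leNye //.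
  rewrite /eta.
  by dotp_lra.
case: (envelope eta) => [h| |] //; rewrite -?EFinB ?lee_fin ?leey //.
by dotp_lra.
Qed.

Lemma B_smooth_representation : B_smooth phi f -> conj_representation phi f.
Proof.
move=> sf; have [df _] := sf; split; first exact: B_smooth_dom.
move=> x Xx; rewrite (B_smooth_envelope sf Xx) EFinB.
rewrite !fineK ?(phi_fin (interior_subset Xx)) ?(B_smooth_fin df Xx) //.
rewrite -(fineK (phi_fin (interior_subset Xx))) -(fineK (B_smooth_fin df Xx)) -!EFinB.
by congr EFin; ring.
Qed.

(** A bound of [f] by [phi] up to an affine function is a local bound, as [phi]
    is continuous on the interior of its domain. *)
Lemma locally_bounded c w x : X^° x ->
  (forall z, X^° z -> (f z <= phi z + (c + dotp w z)%:E)%E) ->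
  exists M : R, \forall z \near x, (f z <= M%:E)%E.
Proof.
move=> Xx H; exists (fine (phi x) + 1 + (c + (dotp w x + 1))).
have d1 := first_order_continuous (differentiable_first_order (dphi Xx)) ltr01.
have d2 : \forall z \near x, dotp w z <= dotp w x + 1.
  by apply: (cvgr_le _ (@dotp_continuous R n w x)); rewrite ltrDl.
apply: filterS3 (nbhs_interior Xx) d1 d2 => z Xz /= le1 le2.
apply: le_trans (H z Xz) _; rewrite -(fineK (phi_fin (interior_subset Xz))).
move: le1; rewrite ler_norml -EFinD lee_fin; lra.
Qed.

Lemma interior_subgradient c w x :
  (forall z, X^° z -> (f z <= phi z + (c + dotp w z)%:E)%E) ->
  X^° x -> exists xi, subgradient X f x xi.
Proof.
move=> H Xx; have [M HM] := locally_bounded Xx H.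
apply: (subgradient_exists cf lf Xx _ HM).
have Xx' := interior_subset Xx; rewrite fin_numElt fNy //=.
apply: le_lt_trans (H x Xx) _.
by have [p ->] := phi_finE Xx'; rewrite -EFinD ltry.
Qed.

(** The descent inequality squeezes [f] between two functions with the same
    first-order expansion. *)
Lemma descent_differentiable x xi : X^° x -> subgradient X f x xi ->
  descent x xi X^° -> differentiable_at X f x /\ grad f x = xi.
Proof.
move=> Xx sub H; apply: (subgradient_squeeze sub) => e e0.
have d1 := differentiable_first_order (dphi Xx) e0.
apply: filterS2 (nbhs_interior Xx) d1 => z Xz /= le1; split; first exact: interior_subset.
apply: le_trans (H z Xz) _; rewrite -(fineK (phi_fin (interior_subset Xz))).
move: le1; rewrite ler_norml -EFinD lee_fin /tangent_gap.
dotp_lra.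
Qed.

(** The Fenchel-Young equalities at [x] evaluate the two conjugates that appear
    as constants in strong convexity. *)
Lemma aniso_conj_descent x xi : conj_aniso_strongly_convex phi f ->
  X^° x -> subgradient X f x xi -> conj_descent x xi.
Proof.
move=> H Xx sub eta.
have := H eta xi x ((limiting_subdiff_fs xi x).2 (subgradient_fenchel sub)) Xx.
rewrite phis_grad // (fenchel_subgradient sub).
have := fs_gtNy eta; case: (fs eta) => [b| |] // _; last by move=> _; exact: leey.
case: (phis _) => [c| |] //; rewrite -?EFinD -?EFinB ?lee_fin ?leNye //.
dotp_lra.
Qed.

Lemma aniso_B_smooth : conj_aniso_strongly_convex phi f -> B_smooth phi f.
Proof.
move=> H; have [x0 [[Xx0 fx0] Xx0']] := f_int.
have finx0 : f x0 \is a fin_num by rewrite fin_numElt fNy.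
have [y [v [Xy suby]]] := interior_subgradient_point cf lf Xx0' finx0.
have D0 := conj_descent_descent (aniso_conj_descent H Xy suby).
have bound z : X^° z -> (f z <= phi z + (fine (f y) - fine (phi y) +
    dotp (grad phi y - v) y + dotp (- (grad phi y - v)) z)%:E)%E.
  move=> Xz; apply: le_trans (D0 z Xz) _; apply: leeD2l; rewrite lee_fin /tangent_gap.
  by dotp_lra.
have sub x : X^° x -> exists xi, subgradient X f x xi.
  exact: interior_subgradient bound.
have D x xi : X^° x -> subgradient X f x xi -> descent x xi X^°.
  by move=> Xx subx; apply: conj_descent_descent; exact: aniso_conj_descent.
split.
  move=> x Xx; have [xi subx] := sub x Xx.
  by have [] := descent_differentiable Xx subx (D x xi Xx subx).
apply: descent_convex; first by move=> x /sub[xi []].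
by move=> x Xx; have [xi subx] := sub x Xx; exists xi; exact: D.
Qed.

(** By convexity, [phi - f] exceeds its value at [x] in average over [z] and the
    mirror image of [z] in [x].  So the distance of [f] at [z] to its support at
    [x] is at most the sum of the remainders of [phi] at these two points. *)
Lemma split_differentiable x xi : X^° x -> (forall z, X^° z -> f z \is a fin_num) ->
  subgradient X f x xi -> convex_fun X^° (fun z => phi z - f z)%E ->
  differentiable_at X f x.
Proof.
move=> Xx finf sub /convex_funP cq.
suff [] : differentiable_at X f x /\ grad f x = xi by [].
apply: (subgradient_squeeze sub) => e e0; have e20 : 0 < e / 2 by rewrite divr_gt0.
have [r r0 rH] : exists2 r, 0 < r & forall z, `|z - x| <= r -> X^° z /\
    `|fine (phi z) - fine (phi x) - dotp (grad phi x) (z - x)| <= e / 2 * `|z - x|.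
  apply/nbhs_dist_leP; apply: filterS2 (nbhs_interior Xx) _ => //.
    by move=> z; exact: conj.
  exact: differentiable_first_order (dphi Xx) _ e20.
apply: filterS (near_dist_le x r0) => z zr.
(* The mirror image of [z] in [x]. *)
pose z' := x - (z - x).
have z'x : z' - x = - (z - x) by rewrite /z' addrC addKr.
have z'r : `|z' - x| <= r by rewrite z'x normrN.
have [Xz le1] := rH z zr; have [Xz' le2] := rH z' z'r.
split; first exact: interior_subset.
have [_ finx Hsub] := sub.
have := Hsub z' (interior_subset Xz').
have h01 : 0 <= (2^-1 : R) <= 1 by rewrite invr_ge0 ler0n invf_le1 ?ler1n.
have [||_] := cq z z' (fine (phi z) - fine (f z)) (fine (phi z') - fine (f z'))
  2^-1 Xz Xz' _ _ h01.
- by rewrite EFinB !fineK ?finf ?phi_fin //; exact: interior_subset.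
- by rewrite EFinB !fineK ?finf ?phi_fin //; exact: interior_subset.
have -> : z + 2^-1 *: (z' - z) = x.
  by apply/rowP => i; rewrite !mxE; field.
rewrite -(fineK (phi_fin (interior_subset Xx))) -(fineK finx).
rewrite -[X in _ -> _ -> (X <= _)%E](fineK (finf z Xz)).
rewrite -[X in _ -> (_ <= X)%E -> _](fineK (finf z' Xz')).
rewrite -EFinB !lee_fin z'x; move: le1 le2; rewrite z'x normrN !dotpNr !ler_norml.
dotp_lra.
Qed.

Lemma representation_B_smooth : conj_representation phi f -> B_smooth phi f.
Proof.
move=> [domf rep].
have finf z : X^° z -> f z \is a fin_num.
  move=> /interior_subset Xz; rewrite fin_numElt fNy //=.
  by move: (Xz); rewrite -{1}domf => -[].
have envE z : X^° z -> fenchel envelope (- z) = (fine (phi z) - fine (f z))%:E.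
  move=> Xz; have := rep z Xz; rewrite -/envelope.
  rewrite -(fineK (finf z Xz)) -(fineK (phi_fin (interior_subset Xz))).
  case: (fenchel envelope _) => [k| |] //; rewrite -EFinB => -[->].
  by rewrite /=; congr EFin; ring.
have cq : convex_fun X^° (fun z => phi z - f z)%E.
  apply/convex_funP => x y a b t Xx Xy fa fb t01.
  have Xm : X^° (x + t *: (y - x)) by exact: interior_convex.
  have kE z : X^° z -> (phi z - f z = fenchel envelope (- z))%E.
    by move=> Xz; rewrite envE // EFinB !fineK ?finf // phi_fin //; exact: interior_subset.
  split=> //; rewrite kE //; rewrite !kE // in fa fb.
  have [_] := (convex_funP _ _).1 (@fenchel_convex _ _ envelope) _ _ _ _ t I I fa fb t01.
  rewrite (_ : - x + t *: (- y - - x) = - (x + t *: (y - x))) //.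
  by apply/rowP => i; rewrite !mxE; ring.
have [x0 [_ Xx0]] := f_int.
have [eta [c hE]] : exists eta c, envelope eta = c%:E.
  apply: contrapT => no.
  have : (fenchel envelope (- x0) <= (fine (phi x0) - fine (f x0) - 1)%:E)%E.
    apply: fenchel_le => eta; case E : (envelope eta) => [c| |]; rewrite /= ?leNye //.
      by case: no; exists eta, c.
    by have := fenchel_ge envelope eta (- x0); rewrite E envE.
  by rewrite envE // lee_fin; lra.
have bound z : X^° z -> (f z <= phi z + (c + dotp eta z)%:E)%E.
  move=> Xz; have := fenchel_ge envelope eta (- z); rewrite envE // hE.
  rewrite -(fineK (finf z Xz)) -(fineK (phi_fin (interior_subset Xz))).
  by rewrite -EFinB -EFinD !lee_fin dotpNr /=; lra.
split=> // x Xx; have [xi sub] := interior_subgradient bound Xx.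
exact: split_differentiable sub cq.
Qed.

End Implications.

(** * Essential smoothness *)

Section EssentiallySmooth.
Context {R : realType} {n : nat}.
Implicit Types (S : set 'rV[R]_n) (f : 'rV[R]_n -> \bar R).
Implicit Types (u v w x y z : 'rV[R]_n) (a b c t r : R).

(** Along a segment from an interior point [x0] to a point [x] with a subgradient
    [v], monotonicity bounds the gradient [g] from below in the direction
    [x0 - x], while a bound [M] of [f] on a ball around [x0] bounds it from above
    in all directions. *)
Lemma segment_gradient_bound S f x0 x v g t r (M : R) :
  0 < r -> (forall z, `|z - x0| <= r -> S z /\ (f z <= M%:E)%E) ->
  subgradient S f x v -> subgradient S f (x0 + t *: (x - x0)) g -> 0 <= t < 1 ->
  r * enorm g <= M - fine (f x) - dotp v (x0 - x).
Proof.
move=> r0 HM [Sx finx Hx] [Su finu Hu] /andP[t0 t1].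
apply: dotp_bound_enorm => // w wr.
have [Sz fz] : S (w + x0) /\ (f (w + x0)%R <= M%:E)%E by apply: HM; rewrite addrK.
have := le_trans (Hu _ Sz) fz; have := Hu x Sx; have := Hx _ Su.
rewrite -(fineK finu) -(fineK finx) !lee_fin /=.
have -> : w + x0 - (x0 + t *: (x - x0)) = w + t *: (x0 - x).
  by apply/rowP => i; rewrite !mxE; ring.
have -> : x0 + t *: (x - x0) - x = (1 - t) *: (x0 - x).
  by apply/rowP => i; rewrite !mxE; ring.
have -> : x - (x0 + t *: (x - x0)) = - ((1 - t) *: (x0 - x)).
  by apply/rowP => i; rewrite !mxE; ring.
rewrite dotpNr (dotpDr _ _ g) !dotpZr.
set p := dotp g (x0 - x); set q := dotp v (x0 - x); set F := fine (f (x0 + _)).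
move=> le1 le2 le3.
have : (1 - t) * q <= (1 - t) * p by lra.
rewrite ler_pM2l; last lra.
nra.
Qed.

Lemma essentially_smooth_dom_subdiff S f : convex_fun S f ->
  (forall z, S z -> (-oo < f z)%E) -> essentially_smooth S f ->
  dom_subdiff S f `<=` (edom S f)^°.
Proof.
move=> cf fNy [[x0 Dx0] df blowup] x [v /(limiting_subdiffP _ _ cf fNy) sub].
apply: contrapT => Dx; have [Sx finx _] := sub.
have Ex : edom S f x by split=> //; case: (f x) finx => // a; rewrite ltry.
pose t (k : nat) : R := 1 - k.+1%:R^-1.
have t01 k : 0 <= t k < 1.
  by rewrite subr_ge0 invf_le1 ?ler1n // gtrBl invr_gt0 ltr0n.
pose u k := x0 + t k *: (x - x0).
have Du k : (edom S f)^° (u k).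
  by apply: interior_segment => //; exact: edom_convex.
have ux : u k @[k --> \oo] --> x.
  have tk : t k @[k --> \oo] --> (1 : R).
    rewrite -[X in _ --> X]subr0; apply: cvgB; first exact: cvg_cst.
    exact: cvg_harmonic.
  have : x0 + t k *: (x - x0) @[k --> \oo] --> x0 + 1 *: (x - x0).
    by apply: cvgD; [exact: cvg_cst|apply: cvgZ => //; exact: cvg_cst].
  by rewrite scale1r subrKC.
have [near0 _] := df x0 Dx0.
have cont := first_order_continuous (differentiable_first_order (df x0 Dx0)) ltr01.
have [r r0 rH] : exists2 r, 0 < r & forall z, `|z - x0| <= r ->
    S z /\ (f z <= (fine (f x0) + 1)%:E)%E.
  apply/nbhs_dist_leP; apply: filterS2 near0 cont => z [Sz finz] /= le1; split=> //.
  by rewrite -(fineK finz) lee_fin; move: le1; rewrite ler_norml; lra.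
have bound k : enorm (grad f (u k)) <=
    (fine (f x0) + 1 - fine (f x) - dotp v (x0 - x)) / r.
  rewrite ler_pdivlMr // mulrC; apply: (segment_gradient_bound r0 rH sub _ (t01 k)).
  by apply: grad_subgradient => //; exact: df (Du k).
have := blowup u x Du ux (conj (subset_closure Ex) Dx).
move=> /cvgryPgt /(_ ((fine (f x0) + 1 - fine (f x) - dotp v (x0 - x)) / r)).
by move=> [k _ /(_ k (leqnn k))] /=; rewrite ltNge bound.
Qed.

End EssentiallySmooth.

(** * Equivalent forms of B-smoothness *)

Unset Implicit Arguments.

Theorem theorem4p10 (R : realType) (n : nat) (phi f : 'rV[R]_n -> \bar R)
    (X := edom setT phi)
    (phi_dgf : dgf phi) (phi_legendre : legendre phi)
    (phi_coercive : one_coercive phi)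
    (f_proper : proper_fun X f) (f_lsc : lsc X f) (f_convex : convex_fun X f)
    (f_int : edom X f `&` X^° !=set0) :
  [/\ [<-> B_smooth phi f;
           conj_representation phi f;
           extended_B_cocoercive phi f;
           conj_aniso_strongly_convex phi f],
      B_smooth phi f -> B_cocoercive phi f,
      dom_subdiff X f `<=` X^° -> B_cocoercive phi f -> B_smooth phi f &
      [/\ B_cocoercive phi f ->
            (dom_subdiff X f `<=` X^° <->
             (dom_subdiff X f = dom_grad X f /\ dom_grad X f = X^°)),
          open X -> dom_subdiff X f `<=` X^° &
          essentially_smooth X f -> dom_subdiff X f `<=` X^°]].
Proof.
have [[_ phiNy'] _ cphi _ dphi] := phi_dgf.
have phiNy z : (-oo < phi z)%E by exact: phiNy'.
have [_ sphi] := phi_legendre.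
have [_ fNy] := f_proper.
have gphis x : X^° x -> grad (fenchel phi) (grad phi x) = x.
  by move=> Xx; have [] := grad_fenchel cphi phiNy sphi dphi Xx.
have e_a : B_cocoercive phi f -> B_smooth phi f.
  exact: cocoercive_B_smooth.
have c_e : extended_B_cocoercive phi f -> B_cocoercive phi f.
  exact: extended_cocoercive_cocoercive.
have a_c : B_smooth phi f -> extended_B_cocoercive phi f.
  exact: B_smooth_cocoercive.
have subX : dom_subdiff X f `<=` X by move=> x [v [[]]].
split.
- tfae.
  + exact: B_smooth_representation.
  + by move=> /(representation_B_smooth cphi phiNy dphi fNy f_lsc f_convex f_int)/a_c.
  + by move=> /c_e/e_a; exact: B_smooth_aniso.
  + exact: aniso_B_smooth.
- by move=> /a_c/c_e.
- by move=> _; exact: e_a.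
split.
- move=> [df _]; have gradX : dom_grad X f = X^°.
    apply/seteqP; split=> [x [nearX _]|]; last exact: df.
    by apply: filterS nearX => y [].
  split=> [sub|[-> ->] //]; split=> //; rewrite gradX; apply/seteqP; split=> // x Xx.
  exists (grad f x); apply: subgradient_limiting_subdiff.
  exact: diff_subgradient.
- by move=> /interior_id ->.
- move=> sf x /(essentially_smooth_dom_subdiff f_convex fNy sf).
  by apply: interiorS => y [].
Qed.
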